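(* Let $n\ge2$ and let $d$ be the Riemannian distance on $SU_n$ induced by the Frobenius metric $\phi$. (a) The diameter of $(SU_n,\phi)$ is $\delta(SU_n,\phi)=\sqrt{n}\,\pi$ if $n$ is even and $\delta(SU_n,\phi)=\sqrt{n-\frac1n}\,\pi$ if $n$ is odd. (b) If $n$ is even and $P\in SU_n$, then $-P$ is the unique point of $SU_n$ diametral to $P$ in $(SU_n,\phi)$, and the set of minimizing geodesic segments joining $P$ and $-P$ can be parametrized by the complex Grassmannian $\mathbf{Gr}(\frac n2;\mathbb{C}^n)$. (c) If $n$ is odd and $P\in SU_n$, then $P$ has exactly two diametral points in $(SU_n,\phi)$, namely $P^+=e^{\frac{(n-1)\pi\mathbf{i}}{n}}P$ and $P^-=e^{-\frac{(n-1)\pi\mathbf{i}}{n}}P$, and the set of minimizing geodesic segments joining $P$ with $P^+$ and the set of those joining $P$ with $P^-$ can both be parametrized by the complex Grassmannian $\mathbf{Gr}(\frac{n-1}2;\mathbb{C}^n)$.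
   Context: $SU_n$ is the special unitary group. The Frobenius metric $\phi$ on $SU_n$ is the (bi-invariant) Riemannian metric induced by the real scalar product $\phi(A,B)=\mathrm{Re}(\mathrm{tr}(AB^* ))$ on $\mathfrak{gl}_n(\mathbb{C})$. The diameter is $\delta(SU_n,\phi)=\sup\{d(P,Q):P,Q\in SU_n\}$; a point $Q$ is diametral to $P$ if $d(P,Q)=\delta(SU_n,\phi)$. $\mathbf{Gr}(k;\mathbb{C}^m)$ denotes the Grassmannian of $k$-dimensional complex subspaces of $\mathbb{C}^m$; ''parametrized by'' means there is a bijection between this manifold (realized as a compact submanifold of $\mathfrak{su}_n$ of minimizing logarithms) and the set of minimizing geodesic segments. *)

(* Defs.v *)
From HB Require Import structures.
From mathcomp Require Import all_boot all_order all_algebra.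
From mathcomp Require Import all_classical all_reals all_analysis.
From mathcomp Require Import complex.
Set Implicit Arguments. Unset Strict Implicit. Unset Printing Implicit Defensive.
Import Order.TTheory GRing.Theory Num.Theory.
Import numFieldNormedType.Exports.
Local Open Scope classical_set_scope.
Local Open Scope ring_scope.
Local Open Scope complex_scope.

Section SUn.
Variables (R : realType) (n : nat).

Local Notation M := 'M[R[i]]_n.

(* conjugate transpose A^* *)
Definition adj (A : M) : M := (map_mx (fun z : R[i] => z^*) A)^T.

(* the special unitary group SU_n *)
Definition SU : set M := [set A | A *m adj A = 1%:M /\ \det A = 1].

(* Frobenius scalar product phi(A,B) = Re tr(A B^* ) and its norm *)
Definition frob_inner (A B : M) : R := complex.Re (\tr (A *m adj B)).
Definition frob (A : M) : R := Num.sqrt (frob_inner A A).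

(* real and imaginary parts of the entries of a matrix-valued curve *)
Definition reC (g : R -> M) (i j : 'I_n) : R -> R := fun t => complex.Re (g t i j).
Definition imC (g : R -> M) (i j : 'I_n) : R -> R := fun t => complex.Im (g t i j).

(* C^1 curves R -> M_n(C) (entrywise, real and imaginary parts) *)
Definition C1 (g : R -> M) : Prop :=
  forall i j,
    (forall t, derivable (reC g i j) t 1) /\ continuous (fun t : R => (derive1 (reC g i j) t : R)) /\
    (forall t, derivable (imC g i j) t 1) /\ continuous (fun t : R => (derive1 (imC g i j) t : R)).

(* velocity g'(t) *)
Definition velocity (g : R -> M) (t : R) : M :=
  \matrix_(i, j) ((derive1 (reC g i j) t) +i* (derive1 (imC g i j) t)).

(* length of g restricted to [0,1] for the Frobenius metric *)
Definition length (g : R -> M) : R :=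
  Rintegral (@lebesgue_measure R) `[0, 1]%classic (fun t => frob (velocity g t)).

(* admissible curves: C^1 curves, staying in SU_n on [0,1], from P to Q *)
Definition admissible (g : R -> M) (P Q : M) : Prop :=
  C1 g /\ (forall t, 0 <= t <= 1 -> SU (g t)) /\ g 0 = P /\ g 1 = Q.

(* Riemannian distance on (SU_n, phi) *)
Definition dist (P Q : M) : R :=
  inf [set L | exists g, admissible g P Q /\ L = length g].

(* diameter of (SU_n, phi) *)
Definition diam : R := sup [set r | exists P Q, SU P /\ SU Q /\ r = dist P Q].

Definition diametral (P Q : M) : Prop := SU Q /\ dist P Q = diam.

(* minimizing geodesic segments from P to Q, parametrized on [0,1]:
   admissible curves of length d(P,Q) with constant speed d(P,Q). *)
Definition min_geod_seg (P Q : M) : set (R -> M) :=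
  [set g | admissible g P Q /\ length g = dist P Q /\
           (forall t, 0 <= t <= 1 -> frob (velocity g t) = dist P Q)].

(* complex Grassmannian Gr(k; C^n), realized as the set of orthogonal
   projections of rank k (a compact subset of M_n(C)) *)
Definition Gr (k : nat) : set M :=
  [set X | adj X = X /\ X *m X = X /\ \rank X = k].

(* S (a set of curves, identified when equal on [0,1]) is parametrized by G:
   there is a bijection F : G -> S (modulo equality on [0,1]) which is a
   homeomorphism for the Frobenius distance on G and the uniform distance
   on [0,1] on curves. *)
Definition same_on01 (g h : R -> M) : Prop := forall t, 0 <= t <= 1 -> g t = h t.

Definition parametrized_by (S : set (R -> M)) (G : set M) : Prop :=
  exists F : M -> (R -> M),
    (forall X, G X -> S (F X)) /\
    (forall g, S g -> exists X, G X /\ same_on01 g (F X)) /\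
    (forall X Y, G X -> G Y -> same_on01 (F X) (F Y) -> X = Y) /\
    (forall X, G X -> forall e : R, 0 < e -> exists2 d : R, 0 < d &
       forall Y, G Y -> frob (X - Y) < d ->
         forall t, 0 <= t <= 1 -> frob (F X t - F Y t) < e) /\
    (forall X, G X -> forall e : R, 0 < e -> exists2 d : R, 0 < d &
       forall Y, G Y ->
         (forall t, 0 <= t <= 1 -> frob (F X t - F Y t) < d) -> frob (X - Y) < e).

End SUn.

(* e^{i theta} *)
Definition expi (R : realType) (theta : R) : R[i] := (cos theta) +i* (sin theta).

(* Main.v *)
Require Import Defs.
From mathcomp Require Import all_boot all_order fingroup perm all_algebra.
From mathcomp Require Import all_classical all_reals all_analysis.
From mathcomp Require Import complex.
From mathcomp Require Import zify ring lra.
Import Order.TTheory GRing.Theory Num.Theory.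
Import numFieldNormedType.Exports.
Local Open Scope classical_set_scope.
Local Open Scope ring_scope.
Set Implicit Arguments. Unset Strict Implicit. Unset Printing Implicit Defensive.

(* A curve in SU(n) from P to -e^{-ib}P has velocity orthogonal, in the Euclidean space M_n(C), to
   the line of scalar matrices iR g, so multiplying it by e^{ib f(t)}, with f growing from 0 to 1
   proportionally to arc length, turns a curve of length L into one of length sqrt (L^2 + n b^2).
   The rotated curve joins P to -P on the sphere of radius sqrt n, where antipodal points are at
   distance sqrt n pi; hence L^2 >= n (pi^2 - b^2).  For b = 0 (n even) and b = +-pi/n (n odd) this
   is the announced diameter, and equality forces the rotated curve to be a great circle
   cos(pi t) P + sin(pi t) P Z, where unitarity makes Z = +-i(1 - 2X) with X an orthogonal
   projection, whose rank is dictated by det = 1.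
   Conversely, the spectral theorem joins P to Q by P exp(t log(P^* Q)), and the
   arguments of the eigenvalues of P^* Q can be chosen with sum zero and spread at most
   2 pi; a convexity argument bounds the sum of their squares, with equality only for scalar
   P^* Q. *)

(** * Curves on the unit sphere of a Euclidean space *)

Lemma cauchy_schwarz (R : realFieldType) (I : finType) (a b : I -> R) :
  (\sum_k a k * b k) ^+ 2 <= (\sum_k a k ^+ 2) * (\sum_k b k ^+ 2).
Proof.
set A := \sum_k a k ^+ 2; set B := \sum_k b k ^+ 2; set C := \sum_k a k * b k.
have A0 : 0 <= A by apply: sumr_ge0 => k _; exact: sqr_ge0.
have expand (x y : R) :
    \sum_k (x * a k + y * b k) ^+ 2 = x ^+ 2 * A + 2 * x * y * C + y ^+ 2 * B.
  rewrite /A /B /C !mulr_sumr -!big_split /=.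
  by apply: eq_bigr => k _; ring.
have nonneg (x y : R) : 0 <= x ^+ 2 * A + 2 * x * y * C + y ^+ 2 * B.
  by rewrite -expand; apply: sumr_ge0 => k _; exact: sqr_ge0.
have [A_eq0|A_neq0] := eqVneq A 0.
  have a0 k : a k = 0.
    move: A_eq0; rewrite /A => /eqP; rewrite psumr_eq0 => [|i _]; last exact: sqr_ge0.
    by move=> /allP /(_ k); rewrite mem_index_enum sqrf_eq0 => /(_ isT) /eqP.
  have -> : C = 0 by rewrite /C big1 // => k _; rewrite a0 mul0r.
  by rewrite A_eq0 mul0r expr0n.
(* At (C, -A) the nonnegative quadratic form equals A (A B - C^2), and A is positive in this
   branch. *)
have := nonneg C (- A).
have -> : C ^+ 2 * A + 2 * C * - A * C + (- A) ^+ 2 * B = A * (A * B - C ^+ 2) by ring.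
by rewrite pmulr_rge0 ?subr_ge0 // lt_def A_neq0.
Qed.

Section SphereCurves.
Variables (R : realType) (I : finType).

Lemma is_derive_fsum (y dy : I -> R -> R) (t : R) :
  (forall k, is_derive t 1 (y k) (dy k t)) ->
  is_derive t 1 (fun x => \sum_k y k x) (\sum_k dy k t).
Proof.
move=> H.
have -> : (fun x => \sum_k y k x) = \sum_k y k.
  by apply/funext => x; rewrite fct_sumE.
by elim/big_ind2 : _ => // [|f df g dg Hf Hg]; [exact: is_derive_cst|exact: is_deriveD].
Qed.

(* With [u t := <y a, y t>] one has |u'| <= s * sqrt (1 - u^2), so that
   [asin (r * u t) + S t] is nondecreasing for every 0 < r < 1; the factor r
   keeps asin away from the points where it is not differentiable. *)
Lemma sphere_curve_ge_cos (y dy : I -> R -> R) (S s : R -> R) (a b : R) :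
  a <= b ->
  (forall k t, a <= t <= b -> is_derive t 1 (y k) (dy k t)) ->
  (forall t, a <= t <= b -> is_derive t 1 S (s t)) ->
  (forall t, a <= t <= b -> 0 <= s t) ->
  (forall t, a <= t <= b -> \sum_k y k t ^+ 2 = 1) ->
  (forall t, a < t < b -> \sum_k dy k t ^+ 2 <= s t ^+ 2) ->
  S b - S a <= pi ->
  cos (S b - S a) <= \sum_k y k a * y k b.
Proof.
move=> ab Dy DS s0 y1 dy_le Sab.
pose u t := \sum_k y k a * y k t.
pose du t := \sum_k y k a * dy k t.
have Du t : a <= t <= b -> is_derive t 1 u (du t).
  move=> tab; apply: (@is_derive_fsum (fun k x => y k a * y k x)
    (fun k x => y k a * dy k x)) => k.
  by have D := Dy k t tab; exact: (is_deriveZ (f := y k) (y k a)).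
have u_le1 t : a <= t <= b -> u t ^+ 2 <= 1.
  move=> tab; apply: le_trans (cauchy_schwarz _ _) _.
  by rewrite !y1 ?lexx ?ab // mulr1.
(* Differentiating |y|^2 = 1 makes y' orthogonal to y; an interior t has a neighbourhood on which
   the constraint holds. *)
have ydy t : a < t < b -> \sum_k y k t * dy k t = 0.
  move=> /andP[at_ tb].
  have tab : a <= t <= b by rewrite !ltW.
  have D2 : is_derive t 1 (fun x => \sum_k y k x ^+ 2) (\sum_k 2 * y k t * dy k t).
    apply: (@is_derive_fsum (fun k x => y k x ^+ 2) (fun k x => 2 * y k x * dy k x)) => k.
    have D := Dy k t tab.
    apply: is_derive_eq (is_deriveX (f := y k) 2 D) _.
    by rewrite expr1.
  have D0 : is_derive t 1 (fun x => \sum_k y k x ^+ 2) 0.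
    apply: near_eq_is_derive (is_derive_cst (1 : R) t 1).
    near=> x; rewrite y1 //.
    have : x \in `]a, b[ by near: x; apply: near_in_itvoo; rewrite in_itv /= at_.
    by rewrite in_itv /= => /andP[/ltW -> /ltW ->].
  have E : \sum_k 2 * y k t * dy k t = 0.
    by rewrite -(@derive_val _ _ _ _ _ _ _ D2) (@derive_val _ _ _ _ _ _ _ D0).
  apply: (@mulfI _ (2 : R)); first by rewrite pnatr_eq0.
  by rewrite mulr0 -[RHS]E mulr_sumr; apply: eq_bigr => k _; rewrite mulrA.
have du_le t : a < t < b -> du t ^+ 2 <= s t ^+ 2 * (1 - u t ^+ 2).
  move=> tab'; have tab : a <= t <= b by case/andP: tab' => /ltW -> /ltW ->.
  (* As y' is orthogonal to y, only the component of [y a] orthogonal to [y t] counts, and its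
     squared norm is 1 - u^2. *)
  have -> : du t = \sum_k (y k a - u t * y k t) * dy k t.
    transitivity (du t - u t * \sum_k y k t * dy k t).
      by rewrite ydy // mulr0 subr0.
    rewrite mulr_sumr -sumrB.
    by apply: eq_bigr => k _; ring.
  apply: le_trans (cauchy_schwarz _ _) _.
  have -> : \sum_k (y k a - u t * y k t) ^+ 2 = 1 - u t ^+ 2.
    transitivity (\sum_k y k a ^+ 2 - 2 * u t * (\sum_k y k a * y k t)
                  + u t ^+ 2 * (\sum_k y k t ^+ 2)).
      move: (u t) => v; rewrite !mulr_sumr -sumrB -big_split /=.
      by apply: eq_bigr => k _; ring.
    rewrite !y1 ?lexx ?ab // -/(u t); move: (u t) => v.
    by ring.
  by rewrite mulrC ler_wpM2r ?dy_le // subr_ge0 u_le1.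
(* Mean value theorem for asin (r u) + S; at a one has u = 1, whence the term [asin r]. *)
have key r : 0 < r < 1 -> asin r + S a <= asin (r * u b) + S b.
  move=> /andP[r0 r1].
  have ru t : a <= t <= b -> (r * u t) ^+ 2 < 1.
    move=> tab; rewrite exprMn; apply: le_lt_trans (_ : r ^+ 2 < 1).
      by rewrite ler_piMr ?sqr_ge0 ?u_le1.
    by rewrite expr_lt1 // ltW.
  have ru1 t : a <= t <= b -> -1 < r * u t < 1.
    by move=> /ru h; rewrite -ltr_norml -(@expr_lt1 _ 2) // real_normK // num_real.
  pose f t := asin (r * u t) + S t.
  pose df t := (Num.sqrt (1 - (r * u t) ^+ 2))^-1 * (r * du t) + s t.
  have Df t : a <= t <= b -> is_derive t 1 f (df t).
    move=> tab; have D1 := is_derive1_asin (ru1 t tab); have D2 := Du t tab.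
    have D3 := DS t tab.
    have D4 : is_derive t 1 (fun x => r * u x) (r * du t).
      exact: (is_deriveZ (f := u) r).
    have D5 := is_derive1_comp (f := asin) (g := fun x => r * u x) D1 D4.
    exact: is_deriveD D5 D3.
  have fc : {within `[a, b], continuous f}.
    apply: derivable_within_continuous => t; rewrite in_itv /= => tab.
    by have D := Df t tab; exact: ex_derive.
  have fa : f a = asin r + S a.
    rewrite /f /u (eq_bigr (fun k => y k a ^+ 2)) => [|k _]; last by rewrite expr2.
    by rewrite y1 ?lexx ?ab // mulr1.
  rewrite -fa -/(f b) -subr_ge0.
  have [abE|aneb] := eqVneq a b; first by rewrite abE subrr.
  have ab' : a < b by rewrite lt_neqAle aneb.
  have [|c + ->] := MVT ab' _ fc (df := df).
    by move=> t; rewrite in_itv /= => /andP[/ltW ? /ltW ?]; apply: Df; apply/andP.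
  rewrite in_itv /= => cab; rewrite mulr_ge0 ?subr_ge0 //.
  have cab' : a <= c <= b by case/andP: cab => /ltW -> /ltW ->.
  have w0 : 0 < 1 - (r * u c) ^+ 2 by rewrite subr_gt0 ru.
  have sw0 : 0 < Num.sqrt (1 - (r * u c) ^+ 2) by rewrite sqrtr_gt0.
  suff : `|r * du c| <= s c * Num.sqrt (1 - (r * u c) ^+ 2).
    rewrite ler_norml => /andP[h _].
    have -> : df c = (Num.sqrt (1 - (r * u c) ^+ 2))^-1 *
        (r * du c + s c * Num.sqrt (1 - (r * u c) ^+ 2)).
      by rewrite /df mulrDr [s c * _]mulrC mulKf ?gt_eqF.
    by rewrite mulr_ge0 ?invr_ge0 ?(ltW sw0) //; lra.
  rewrite -(@ler_pXn2r _ 2) ?nnegrE ?mulr_ge0 ?s0 ?sqrtr_ge0 //.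
  rewrite real_normK ?num_real // [leRHS]exprMn sqr_sqrtr ?(ltW w0) // exprMn.
  (* What remains is r^2 (1 - u^2) <= 1 - r^2 u^2. *)
  have r2 : r ^+ 2 <= 1 by rewrite expr_le1 // ltW.
  apply: le_trans (_ : r ^+ 2 * (s c ^+ 2 * (1 - u c ^+ 2)) <= _).
    by rewrite ler_wpM2l ?sqr_ge0 ?du_le.
  rewrite mulrCA ler_wpM2l ?sqr_ge0 // exprMn mulrBr mulr1.
  by rewrite lerD2r.
have u1b : -1 <= u b.
  have : u b ^+ 2 <= 1 by apply: u_le1; rewrite lexx ab.
  by rewrite -(real_normK (num_real _)) expr_le1 // ler_norml => /andP[].
have SabP : 0 <= S b - S a.
  have Sc : {within `[a, b], continuous S}.
    apply: derivable_within_continuous => t; rewrite in_itv /= => tab.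
    by have D := DS t tab; exact: ex_derive.
  have [abE|aneb] := eqVneq a b; first by rewrite abE subrr.
  have ab' : a < b by rewrite lt_neqAle aneb.
  have [|c + ->] := MVT ab' _ Sc (df := s).
    by move=> t; rewrite in_itv /= => /andP[/ltW ? /ltW ?]; apply: DS; apply/andP.
  rewrite in_itv /= => /andP[/ltW ac /ltW cb].
  by rewrite mulr_ge0 ?subr_ge0 // s0 ?ac.
rewrite -/(u b); set d := S b - S a in Sab SabP *.
have [dpi|dneqpi] := eqVneq d pi; first by rewrite dpi cospi.
have dltpi : d < pi by rewrite lt_neqAle dneqpi.
(* Suppose u b = cos d - c with c > 0. For r = sin th, [key] yields sin (th - d) <= sin th * u b,
   that is c sin th <= cos th sin d, which fails for th close to pi/2. *)
rewrite leNgt; apply/negP => ult.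
set c := cos d - u b; have c0 : 0 < c by rewrite subr_gt0.
have pi0 := pi_gt0 R.
have d_itv : (d - pi / 2 \in `](- (pi / 2)), (pi / 2)[%R) \/ d = 0.
  have [->|dn0] := eqVneq d 0; [by right|left].
  have : 0 < d by rewrite lt_neqAle eq_sym dn0.
  by rewrite in_itv /=; move=> ?; apply/andP; split; lra.
(* The first bound puts th - d above -pi/2, where sin is increasing; the second means tan th > 1/c.
   So th = atan M with M larger than 1/c and than tan (d - pi/2). For d = 0 the latter angle is a
   pole of tan, but th > 0 suffices. *)
have [th /andP[th0 th1] [thd thc]] : exists2 th : R, (0 < th < pi / 2) &
    d - pi / 2 < th /\ cos th < c * sin th.
  pose M := 2 / c + `|tan (d - pi / 2)|.
  have M0 : 0 < M by rewrite ltr_wpDr // divr_gt0.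
  have A1 := atan_ltpi2 M.
  have A2 : 0 < atan M by rewrite -(atan0 R) lt_atan.
  have cA : 0 < cos (atan M) by rewrite cos_gt0_pihalf //; apply/andP; split; lra.
  exists (atan M); first by rewrite A2 A1.
  split.
    case: d_itv => [/tanK <-|->]; last by lra.
    apply: lt_atan; rewrite (le_lt_trans (ler_norm _)) // ltrDr divr_gt0 //.
  have -> : sin (atan M) = M * cos (atan M).
    by rewrite -{2}(atanK M) /tan divfK ?gt_eqF.
  rewrite mulrA ltr_pMl // mulrDr mulrCA divff ?gt_eqF //.
  by rewrite mulr1 ltr_wpDr ?mulr_ge0 ?(ltW c0) ?ltr1n.
have sth : 0 < sin th by apply: sin_gt0_pihalf; rewrite th0.
have sth1 : sin th < 1.
  rewrite -(sin_pihalf R) ltr_sin ?th1 // in_itv /=; apply/andP; split; lra.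
have := key (sin th); rewrite sth sth1 sinK; last first.
  by rewrite in_itv /=; apply/andP; split; lra.
move=> /(_ isT) K.
have {}K : th - d <= asin (sin th * u b) by rewrite /d; lra.
have ub1 : u b <= 1 by apply: le_trans (ltW ult) (cos_le1 _).
have su : -1 <= sin th * u b <= 1.
  by apply/andP; split; nra.
have : sin (th - d) <= sin th * u b.
  rewrite -[leRHS]asinK; last by rewrite in_itv.
  have [A1 A2] := (asin_geNpi2 su, asin_lepi2 su).
  by rewrite leNgt ltr_sin -?leNgt // in_itv /=; apply/andP; split; lra.
rewrite leNgt => /negP; apply; rewrite sinB.
have : cos th * sin d <= cos th.
  by rewrite ler_piMr ?sin_le1 // cos_ge0_pihalf //; apply/andP; split; lra.
move: thc; rewrite /c mulrBl; nra.
Unshelve. all: by end_near.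
Qed.

End SphereCurves.

(** * Unit complex numbers and their arguments *)

Section Expi.
Variable R : realType.
Implicit Types a b : R.

Lemma expi0 : expi (0 : R) = 1.
Proof. by rewrite /expi cos0 sin0. Qed.

Lemma expiD a b : expi (a + b) = expi a * expi b.
Proof.
rewrite /expi cosD sinD; apply/eqP; rewrite eq_complex /= eqxx /=.
by apply/eqP; ring.
Qed.

Lemma expi_pi : expi (pi : R) = -1.
Proof. by rewrite /expi cospi sinpi; apply/eqP; rewrite eq_complex /= oppr0 !eqxx. Qed.

Lemma conjc_expi a : ((expi a)^*)%C = expi (- a).
Proof. by rewrite /expi cosN sinN. Qed.

Lemma expiK a : expi a * expi (- a) = 1.
Proof. by rewrite -expiD subrr expi0. Qed.

Lemma expi_sum (I : finType) (f : I -> R) : expi (\sum_k f k) = \prod_k expi (f k).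
Proof. by elim/big_rec2 : _ => [|k y1 y2 _ <-]; rewrite ?expi0 ?expiD. Qed.

(** The cosine alone decides: it is injective on [0, pi], and the reflections a -> 2 pi - a and a ->
    -a bring the other cases there. *)
Lemma expi_eq1 a : - (2 * pi) < a < 2 * pi -> expi a = 1 -> a = 0.
Proof.
move=> /andP[a1 a2] [ca sa]; have pi0 := pi_gt0 R.
have aux b : 0 <= b < 2 * pi -> cos b = 1 -> b = 0.
  move=> /andP[b0 b1] cb.
  have [bpi|bpi] := leP b pi.
    by apply: cos_inj; rewrite ?in_itv /= ?b0 ?bpi ?lexx ?(ltW pi0) // cos0.
  have : 2 * pi - b = 0.
    apply: cos_inj; rewrite ?in_itv /= ?lexx ?(ltW pi0) ?cos0 //.
      by apply/andP; split; lra.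
    by rewrite mulr_natl cosB cos2pi sin2pi cb mul0r mul1r addr0.
  lra.
have [a0|a0] := leP 0 a; first by apply: aux; rewrite ?a0.
by apply/eqP; rewrite -oppr_eq0; apply/eqP/aux; rewrite ?cosN //; apply/andP; split; lra.
Qed.

(** The argument is acos of the real part, replaced by 2 pi - acos x below the real axis. *)
Lemma expi_surj (z : R[i]) : z * (z^*)%C = 1 -> exists2 a, 0 <= a < 2 * pi & z = expi a.
Proof.
case: z => x y /eqP; rewrite eq_complex /= => /andP[/eqP xy _].
have {}xy : x ^+ 2 + y ^+ 2 = 1 by rewrite -xy mulrN opprK !expr2.
have pi0 := pi_gt0 R.
have x1 : -1 <= x <= 1.
  by rewrite -ler_norml -(@expr_le1 _ 2) // real_normK ?num_real // -xy lerDl sqr_ge0.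
have ca : cos (acos x) = x by apply: acosK; rewrite in_itv.
have sa : sin (acos x) = `|y|.
  by rewrite sin_acos // -xy addrC addKr sqrtr_sqr.
have [A0 A1] := (acos_ge0 x1, acos_lepi x1).
have [y0|y0] := leP 0 y.
  exists (acos x); first by apply/andP; split; lra.
  by rewrite /expi ca sa ger0_norm.
exists (2 * pi - acos x).
  (* The upper bound is strict: acos x = 0 would make the imaginary part 0, while it is negative
     here. *)
  apply/andP; split; first by lra.
  suff an0 : acos x != 0.
    by have : 0 < acos x by [rewrite lt_neqAle eq_sym an0]; lra.
  apply/eqP => E; move: sa; rewrite E sin0 => /esym/eqP; rewrite normr_eq0 => /eqP.
  by move=> yE; move: y0; rewrite yE ltxx.
rewrite /expi mulr_natl cosB sinB cos2pi sin2pi ca sa ltr0_norm //.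
by congr (_ +i* _)%C; ring.
Qed.

(** Counts the full turns in a sum of N arguments taken in [0, 2 pi). *)
Lemma expi_eq1_nat (N : nat) a :
  0 <= a < 2 * pi * N%:R -> expi a = 1 -> exists2 m : nat, (m < N)%N & a = 2 * pi * m%:R.
Proof.
have pi0 := pi_gt0 R.
elim: N a => [|N IH] a /andP[a0 aN] ea; first by move: aN; rewrite mulr0 ltNge a0.
have [a2|a2] := ltP a (2 * pi).
  exists 0%N => //; rewrite mulr0; apply: expi_eq1 => //.
  by apply/andP; split; lra.
have [||m mN am] := IH (a - 2 * pi).
- by move: aN; rewrite -(natr1 N) mulrDr => aN; apply/andP; split; lra.
- rewrite expiD ea mul1r /expi cosN sinN mulr_natl cos2pi sin2pi oppr0 //.
exists m.+1 => //; rewrite -(natr1 m); lra.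
Qed.

End Expi.

(** * Unitary matrices and the Frobenius inner product *)

(* Coordinates for the identification of M_n(C) with a real Euclidean space. *)
Definition crd (R : realType) (n : nat) (A : 'M[R[i]]_n) (k : 'I_n * 'I_n * bool) : R :=
  if k.2 then complex.Re (A k.1.1 k.1.2) else complex.Im (A k.1.1 k.1.2).

Section Frobenius.
Variables (R : realType) (n : nat).
Local Notation M := 'M[R[i]]_n.
Implicit Types A B U V X : M.

Lemma adjmxM A B : adj (A *m B) = adj B *m adj A.
Proof. by rewrite /adj (map_mxM conjc) trmx_mul. Qed.

Lemma adjmxK A : adj (adj A) = A.
Proof. by apply/matrixP => i j; rewrite !mxE conjcK. Qed.

Lemma adjmxD A B : adj (A + B) = adj A + adj B.
Proof. by apply/matrixP => i j; rewrite !mxE rmorphD. Qed.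

Lemma adjmxZ (c : R[i]) A : adj (c *: A) = (c^*)%C *: adj A.
Proof. by apply/matrixP => i j; rewrite !mxE rmorphM. Qed.

Lemma adjmx1 : adj (1%:M : M) = 1%:M.
Proof. by apply/matrixP => i j; rewrite !mxE rmorph_nat eq_sym. Qed.

Lemma adjmx_diag (d : 'rV[R[i]]_n) : adj (diag_mx d) = diag_mx (map_mx (fun z : R[i] => (z^*)%C) d).
Proof.
apply/matrixP => i j; rewrite !mxE rmorphMn /= eq_sym.
by case: eqVneq => [->|]; rewrite ?mulr0n.
Qed.

Lemma det_adj A : \det (adj A) = ((\det A)^*)%C.
Proof. by rewrite /adj det_tr (det_map_mx conjc). Qed.

Lemma unitary_comm U : U *m adj U = 1%:M -> adj U *m U = 1%:M.
Proof. exact: mulmx1C. Qed.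

Lemma unitaryM U V : U *m adj U = 1%:M -> V *m adj V = 1%:M ->
  (U *m V) *m adj (U *m V) = 1%:M.
Proof. by move=> uU uV; rewrite adjmxM -mulmxA (mulmxA V) uV mul1mx. Qed.

Lemma SU_mul U V : SU U -> SU V -> SU (U *m V).
Proof.
by move=> [uU dU] [uV dV]; split; [exact: unitaryM|rewrite det_mulmx dU dV mulr1].
Qed.

Lemma SU_adj U : SU U -> SU (adj U).
Proof.
by move=> [uU dU]; split; [rewrite adjmxK unitary_comm|rewrite det_adj dU rmorph1].
Qed.

(** Turns the Frobenius product into a Euclidean one, so that the results on spheres of real
    coordinate vectors apply to matrices. *)
Lemma frob_innerE A B : frob_inner A B = \sum_k crd A k * crd B k.
Proof.
rewrite /frob_inner /mxtrace raddf_sum /=.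
rewrite [RHS](eq_bigr (fun k => crd A (k.1, k.2) * crd B (k.1, k.2))); last by case.
rewrite -(pair_bigA _ (fun p b => crd A (p, b) * crd B (p, b))) /=.
rewrite [RHS](eq_bigr (fun p => \sum_b crd A (p.1, p.2, b) * crd B (p.1, p.2, b))); last by case.
rewrite -(pair_bigA _ (fun i j => \sum_b crd A (i, j, b) * crd B (i, j, b))) /=.
apply: eq_bigr => i _; rewrite !mxE raddf_sum /=; apply: eq_bigr => j _.
rewrite big_bool /crd /= !mxE.
by case: (A i j) => a b; case: (B i j) => c d /=; rewrite mulrN opprK.
Qed.

Lemma frob_inner_ge0 A : 0 <= frob_inner A A.
Proof. by rewrite frob_innerE; apply: sumr_ge0 => k _; rewrite -expr2 sqr_ge0. Qed.

Lemma frob_ge0 A : 0 <= frob A.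
Proof. exact: sqrtr_ge0. Qed.

Lemma frob_sqr A : frob A ^+ 2 = frob_inner A A.
Proof. by rewrite sqr_sqrtr // frob_inner_ge0. Qed.

Lemma frob_sqrE A : frob A ^+ 2 = \sum_k crd A k ^+ 2.
Proof. by rewrite frob_sqr frob_innerE; apply: eq_bigr => k _; rewrite expr2. Qed.

Lemma crdD A B k : crd (A + B) k = crd A k + crd B k.
Proof. by rewrite /crd !mxE; case: (k.2); rewrite raddfD. Qed.

Lemma crdN A k : crd (- A) k = - crd A k.
Proof. by rewrite /crd !mxE; case: (k.2); rewrite raddfN. Qed.

Lemma frob_innerC A B : frob_inner A B = frob_inner B A.
Proof. by rewrite !frob_innerE; apply: eq_bigr => k _; rewrite mulrC. Qed.

Lemma frob_innerDl A B X : frob_inner (A + B) X = frob_inner A X + frob_inner B X.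
Proof.
by rewrite !frob_innerE -big_split; apply: eq_bigr => k _; rewrite crdD mulrDl.
Qed.

Lemma frob_innerNl A X : frob_inner (- A) X = - frob_inner A X.
Proof. by rewrite !frob_innerE -sumrN; apply: eq_bigr => k _; rewrite crdN mulNr. Qed.

Lemma frob_innerDr X A B : frob_inner X (A + B) = frob_inner X A + frob_inner X B.
Proof. by rewrite frob_innerC frob_innerDl !(frob_innerC X). Qed.

Lemma frob_innerNr X A : frob_inner X (- A) = - frob_inner X A.
Proof. by rewrite frob_innerC frob_innerNl (frob_innerC X). Qed.

Lemma frob_innerZl (c : R) A X : frob_inner (c%:C%C *: A) X = c * frob_inner A X.
Proof.
rewrite !frob_innerE mulr_sumr; apply: eq_bigr => k _; rewrite mulrA; congr (_ * _).
by rewrite /crd !mxE; case: (A _ _) => x y; case: (k.2) => /=; rewrite mul0r ?subr0 ?addr0.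
Qed.

Lemma frob_innerZr (c : R) X A : frob_inner X (c%:C%C *: A) = c * frob_inner X A.
Proof. by rewrite frob_innerC frob_innerZl frob_innerC. Qed.

Lemma frob_inner_unit (z : R[i]) A B : z * (z^*)%C = 1 ->
  frob_inner (z *: A) (z *: B) = frob_inner A B.
Proof.
move=> z1; rewrite /frob_inner adjmxZ -scalemxAl -scalemxAr scalerA.
by rewrite z1 scale1r.
Qed.

Lemma frob_unit (z : R[i]) A : z * (z^*)%C = 1 -> frob (z *: A) = frob A.
Proof. by move=> z1; rewrite /frob frob_inner_unit. Qed.

Lemma frobZ (c : R) A : frob (c%:C%C *: A) = `|c| * frob A.
Proof.
rewrite /frob frob_innerZl frob_innerZr mulrA -expr2.
by rewrite sqrtrM ?sqr_ge0 // sqrtr_sqr.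
Qed.

Lemma frob_inner_mul U A B : U *m adj U = 1%:M ->
  frob_inner (U *m A) (U *m B) = frob_inner A B.
Proof.
move=> uU; rewrite /frob_inner adjmxM mxtrace_mulC -mulmxA (mulmxA (adj U)).
by rewrite unitary_comm // mul1mx mxtrace_mulC.
Qed.

Lemma frob_mul U A : U *m adj U = 1%:M -> frob (U *m A) = frob A.
Proof. by move=> uU; rewrite /frob frob_inner_mul. Qed.

Lemma frob_mulr U A : U *m adj U = 1%:M -> frob (A *m U) = frob A.
Proof.
move=> uU; rewrite /frob /frob_inner adjmxM -mulmxA (mulmxA U).
by rewrite uU mul1mx.
Qed.

Lemma frob_unitary U : U *m adj U = 1%:M -> frob_inner U U = n%:R.
Proof. by move=> uU; rewrite /frob_inner uU mxtrace1 raddfMn. Qed.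

Lemma frob_eq0 A : frob_inner A A = 0 -> A = 0.
Proof.
rewrite frob_innerE => /eqP; rewrite psumr_eq0 => [|k _]; last by rewrite -expr2 sqr_ge0.
move=> /allP A0; apply/matrixP => i j; rewrite mxE; apply/eqP; rewrite eq_complex.
have := A0 (i, j, true) (mem_index_enum _); have := A0 (i, j, false) (mem_index_enum _).
by rewrite /crd /= -!expr2 !sqrf_eq0 => -> ->.
Qed.

Lemma frob_diag (d : 'rV[R[i]]_n) :
  frob_inner (diag_mx d) (diag_mx d) = \sum_k complex.Re (d 0 k * ((d 0 k)^*)%C).
Proof.
rewrite /frob_inner adjmx_diag mulmx_diag mxtrace_diag raddf_sum.
by apply: eq_bigr => k _; rewrite !mxE.
Qed.

End Frobenius.

(** * Derivatives of complex-valued functions of a real variable *)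

(** Taken on real and imaginary parts, to match [C1] and [velocity]. *)
Definition is_cderive (R : realType) (f : R -> R[i]) (t : R) (l : R[i]) : Prop :=
  is_derive t 1 (fun x => complex.Re (f x)) (complex.Re l) /\
  is_derive t 1 (fun x => complex.Im (f x)) (complex.Im l).

Section ComplexDerivative.
Variable R : realType.
Implicit Types (f g : R -> R[i]) (t : R) (z : R[i]).

Lemma is_cderive_cst z t : is_cderive (fun=> z) t 0.
Proof. by split; exact: is_derive_cst. Qed.

Lemma is_cderiveD f g t l m : is_cderive f t l -> is_cderive g t m ->
  is_cderive (fun x => f x + g x) t (l + m).
Proof.
move=> [fr fi] [gr gi]; split.
  have -> : (fun x => complex.Re (f x + g x)) =
            (fun x => complex.Re (f x)) + (fun x => complex.Re (g x)).
    by apply/funext => x; rewrite raddfD.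
  by rewrite raddfD; exact: is_deriveD.
have -> : (fun x => complex.Im (f x + g x)) =
          (fun x => complex.Im (f x)) + (fun x => complex.Im (g x)).
  by apply/funext => x; rewrite raddfD.
by rewrite raddfD; exact: is_deriveD.
Qed.

Lemma ReM (z w : R[i]) :
  complex.Re (z * w) = complex.Re z * complex.Re w - complex.Im z * complex.Im w.
Proof. by case: z w => [a b] [c d]. Qed.

Lemma ImM (z w : R[i]) :
  complex.Im (z * w) = complex.Re z * complex.Im w + complex.Im z * complex.Re w.
Proof. by case: z w => [a b] [c d]. Qed.

Lemma is_cderiveM f g t l m : is_cderive f t l -> is_cderive g t m ->
  is_cderive (fun x => f x * g x) t (l * g t + f t * m).
Proof.
move=> [fr fi] [gr gi]; split.
  have -> : (fun x => complex.Re (f x * g x)) =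
            (fun x => complex.Re (f x)) * (fun x => complex.Re (g x)) -
            (fun x => complex.Im (f x)) * (fun x => complex.Im (g x)).
    by apply/funext => x; rewrite ReM.
  apply: is_derive_eq (is_deriveB (is_deriveM fr gr) (is_deriveM fi gi)) _.
  by rewrite [in RHS]raddfD /= !ReM /GRing.scale /=; ring.
have -> : (fun x => complex.Im (f x * g x)) =
          (fun x => complex.Re (f x)) * (fun x => complex.Im (g x)) +
          (fun x => complex.Im (f x)) * (fun x => complex.Re (g x)).
  by apply/funext => x; rewrite ImM.
apply: is_derive_eq (is_deriveD (is_deriveM fr gi) (is_deriveM fi gr)) _.
by rewrite [in RHS]raddfD /= !ImM /GRing.scale /=; ring.
Qed.

Lemma is_cderive_sum (I : Type) (s : seq I) (P : pred I) (f : I -> R -> R[i]) t (l : I -> R[i]) :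
  (forall k, is_cderive (f k) t (l k)) ->
  is_cderive (fun x => \sum_(k <- s | P k) f k x) t (\sum_(k <- s | P k) l k).
Proof.
move=> Df; elim: s => [|k s IH].
  rewrite big_nil; have -> : (fun x => \sum_(k <- [::] | P k) f k x) = fun=> 0.
    by apply/funext => x; rewrite big_nil.
  exact: is_cderive_cst.
rewrite big_cons; have -> : (fun x => \sum_(k <- k :: s | P k) f k x) =
    fun x => if P k then f k x + \sum_(k <- s | P k) f k x else \sum_(k <- s | P k) f k x.
  by apply/funext => x; rewrite big_cons.
by case: (P k) => //; exact: is_cderiveD.
Qed.

Lemma is_cderive_prod n (f : 'I_n -> R -> R[i]) t (l : 'I_n -> R[i]) :
  (forall k, is_cderive (f k) t (l k)) ->
  is_cderive (fun x => \prod_k f k x) t (\sum_k l k * \prod_(j | j != k) f j t).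
Proof.
elim: n f l => [|n IH] f l Df.
  rewrite big_ord0; have -> : (fun x => \prod_(k < 0) f k x) = fun=> 1.
    by apply/funext => x; rewrite big_ord0.
  exact: is_cderive_cst.
have -> : (fun x => \prod_k f k x) = fun x => f ord0 x * \prod_k f (lift ord0 k) x.
  by apply/funext => x; rewrite big_ord_recl.
have := is_cderiveM (Df ord0) (IH (fun k => f (lift ord0 k)) (fun k => l (lift ord0 k))
  (fun k => Df (lift ord0 k))).
congr is_cderive; rewrite [RHS]big_ord_recl; congr (_ * _ + _).
  by rewrite [RHS]big_mkcond [RHS]big_ord_recl /= mul1r; apply: eq_bigr.
rewrite mulr_sumr; apply: eq_bigr => k _; rewrite mulrCA; congr (_ * _).
rewrite [RHS]big_mkcond [RHS]big_ord_recl /=; congr (_ * _).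
by rewrite [LHS]big_mkcond; apply: eq_bigr => j _; rewrite (inj_eq lift_inj).
Qed.

Lemma is_cderive_expi (f : R -> R) t df : is_derive t 1 f df ->
  is_cderive (fun x => expi (f x)) t ((0 +i* df)%C * expi (f t)).
Proof.
move=> D; split; rewrite /expi /=.
  apply: is_derive_eq (is_derive1_comp (is_derive_cos (f t)) D) _.
  by rewrite mul0r sub0r mulrC mulrN.
apply: is_derive_eq (is_derive1_comp (is_derive_sin (f t)) D) _.
by rewrite mul0r add0r mulrC.
Qed.

Lemma is_cderive_near f g t l : (\forall x \near t, f x = g x) ->
  is_cderive f t l -> is_cderive g t l.
Proof.
move=> fg [fr fi]; split.
  by apply: near_eq_is_derive fr; apply: filterS fg => x ->.
by apply: near_eq_is_derive fi; apply: filterS fg => x ->.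
Qed.

Lemma is_cderive_unique f t l m : is_cderive f t l -> is_cderive f t m -> l = m.
Proof.
move=> [lr li] [mr mi]; apply/eqP; rewrite eq_complex; apply/andP; split; apply/eqP.
  by rewrite -(@derive_val _ _ _ _ _ _ _ lr) (@derive_val _ _ _ _ _ _ _ mr).
by rewrite -(@derive_val _ _ _ _ _ _ _ li) (@derive_val _ _ _ _ _ _ _ mi).
Qed.

End ComplexDerivative.

(** * Curves of matrices in SU(n) and their phase rotation *)

Section MatrixCurves.
Variables (R : realType) (n : nat).
Local Notation M := 'M[R[i]]_n.
Implicit Types (g dg : R -> M) (t : R).

Definition is_mderive g t (l : M) : Prop :=
  forall i j, is_cderive (fun x => g x i j) t (l i j).

Lemma is_mderiveMl (A : M) g t l : is_mderive g t l ->
  is_mderive (fun x => A *m g x) t (A *m l).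
Proof.
move=> Dg i j; rewrite mxE.
have -> : (fun x => (A *m g x) i j) = fun x => \sum_k A i k * g x k j.
  by apply/funext => x; rewrite mxE.
apply: (@is_cderive_sum _ _ _ _ (fun k x => A i k * g x k j)) => k.
have := is_cderiveM (is_cderive_cst (A i k) t) (Dg k j).
by rewrite mul0r add0r.
Qed.

Lemma is_mderiveMr (A : M) g t l : is_mderive g t l ->
  is_mderive (fun x => g x *m A) t (l *m A).
Proof.
move=> Dg i j; rewrite mxE.
have -> : (fun x => (g x *m A) i j) = fun x => \sum_k g x i k * A k j.
  by apply/funext => x; rewrite mxE.
apply: (@is_cderive_sum _ _ _ _ (fun k x => g x i k * A k j)) => k.
have := is_cderiveM (Dg i k) (is_cderive_cst (A k j) t).
by rewrite mulr0 addr0.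
Qed.

Lemma is_mderive_phase (f : R -> R) df g t l :
  is_derive t 1 f df -> is_mderive g t l ->
  is_mderive (fun x => expi (f x) *: g x) t
    (expi (f t) *: (l + (0 +i* df)%C *: g t)).
Proof.
move=> Df Dg i j; rewrite !mxE.
have -> : (fun x => (expi (f x) *: g x) i j) = fun x => expi (f x) * g x i j.
  by apply/funext => x; rewrite mxE.
have := is_cderiveM (is_cderive_expi Df) (Dg i j).
by congr is_cderive; ring.
Qed.

Lemma is_derive_crd g t l k : is_mderive g t l ->
  is_derive t 1 (fun x => crd (g x) k) (crd l k).
Proof.
by move=> Dg; rewrite /crd; have [] := Dg k.1.1 k.1.2; case: (k.2).
Qed.

(** Leibniz expansion: at the identity matrix only the identity permutation contributes to first
    order. *)
Lemma is_cderive_det1 g t l : g t = 1%:M -> is_mderive g t l ->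
  is_cderive (fun x => \det (g x)) t (\tr l).
Proof.
move=> g1 Dg; rewrite /determinant.
have -> : \tr l = \sum_(s : 'S_n) (0 * \prod_i g t i (s i) +
    (-1) ^+ s * \sum_k l k (s k) * \prod_(j | j != k) g t j (s j)).
  rewrite (bigD1 (1%g : 'S_n)) //= [X in _ + X]big1 => [|s s1].
    rewrite addr0 mul0r add0r odd_perm1 expr0 mul1r; apply: eq_bigr => k _.
    rewrite perm1 big1 ?mulr1 // => j _.
    by rewrite perm1 g1 mxE eqxx.
  rewrite mul0r add0r big1 ?mulr0 // => k _.
  (* A permutation other than 1 moves at least two indices, hence one different from k; its factor
     is an off-diagonal entry of the identity matrix. *)
  have [j jk sj] : exists2 j : 'I_n, j != k & s j != j.
    apply/exists_inP; apply: contraNT s1; rewrite negb_exists_in => /forall_inP sfix.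
    have {}sfix j : j != k -> s j = j by move=> /sfix; rewrite negbK => /eqP.
    apply/eqP/permP => j; rewrite perm1; have [->|] := eqVneq j k; last exact: sfix.
    apply/eqP; apply: contraT => skk; move: (skk).
    by rewrite -(inj_eq (@perm_inj _ s)) sfix // eqxx.
  rewrite (bigD1 j) //= g1 mxE eq_sym (negPf sj) mul0r mulr0 //.
apply: (@is_cderive_sum _ _ _ _ (fun (s : 'S_n) x => (-1) ^+ s * \prod_i g x i (s i))) => s.
apply: (is_cderiveM (is_cderive_cst ((-1) ^+ s) t)).
exact: (@is_cderive_prod _ _ (fun i x => g x i (s i)) _ (fun i => l i (s i))).
Qed.

(* Jacobi's formula at the identity, applied to [x |-> g(t)^* g(x)]. *)
Lemma SU_curve_trace0 g t l a b : a < t < b ->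
  (forall x, a <= x <= b -> SU (g x)) -> is_mderive g t l ->
  \tr (l *m adj (g t)) = 0.
Proof.
move=> /andP[at_ tb] gSU Dg.
have tab : a <= t <= b by rewrite !ltW.
have [ut dt] := gSU t tab.
rewrite mxtrace_mulC.
have D1 := is_cderive_det1 (unitary_comm ut) (is_mderiveMl (adj (g t)) Dg).
apply: is_cderive_unique D1 _.
apply: is_cderive_near (is_cderive_cst 1 t).
near=> x.
have : x \in `]a, b[ by near: x; apply: near_in_itvoo; rewrite in_itv /= at_.
rewrite in_itv /= => /andP[/ltW ax /ltW xb].
have [_ dx] : SU (adj (g t) *m g x) by apply: SU_mul; [exact: SU_adj|apply: gSU; rewrite ax].
by rewrite dx.
Unshelve. all: by end_near.
Qed.

(** The phase is an isometry, the cross terms are multiples of the vanishing trace up to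
    conjugation, and a unitary A has squared norm n. *)
Lemma frob_phase_velocity (A l : M) (th df : R) : A *m adj A = 1%:M ->
  \tr (l *m adj A) = 0 ->
  frob (expi th *: (l + (0 +i* df)%C *: A)) ^+ 2 = frob l ^+ 2 + n%:R * df ^+ 2.
Proof.
move=> uA trl.
rewrite (@frob_unit _ _ (expi th)); last by rewrite conjc_expi expiK.
rewrite !frob_sqr frob_innerDl !frob_innerDr.
have -> : frob_inner l ((0 +i* df)%C *: A) = 0.
  by rewrite /frob_inner adjmxZ -scalemxAr mxtraceZ trl mulr0.
have -> : frob_inner ((0 +i* df)%C *: A) l = 0.
  by rewrite frob_innerC /frob_inner adjmxZ -scalemxAr mxtraceZ trl mulr0.
rewrite addr0 add0r; congr (_ + _).
rewrite /frob_inner adjmxZ -scalemxAr -scalemxAl uA scalerA mxtraceZ mxtrace1.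
rewrite ReM; have -> : complex.Im (n%:R : R[i]) = 0.
  by elim: n => //= m IH; rewrite -natr1 raddfD /= IH addr0.
rewrite mulr0 subr0 mulrC; congr (_ * _); first by rewrite raddfMn.
by rewrite /= mul0r mulNr opprK add0r expr2.
Qed.

(* The scalar matrices being orthogonal to su(n), the rotated curve
   [expi f *: g] has squared speed |g'|^2 + n f'^2; it lies on the sphere of radius sqrt n of
   the real Euclidean space M_n(C). *)
Lemma phase_curve_ge_cos (g dg : R -> M) (f df S s : R -> R) (a b : R) :
  (0 < n)%N -> a <= b ->
  (forall t, a <= t <= b -> is_mderive g t (dg t)) ->
  (forall t, a <= t <= b -> is_derive t 1 f (df t)) ->
  (forall t, a <= t <= b -> is_derive t 1 S (s t)) ->
  (forall t, a <= t <= b -> 0 <= s t) ->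
  (forall t, a <= t <= b -> SU (g t)) ->
  (forall t, a < t < b -> frob (dg t) ^+ 2 + n%:R * df t ^+ 2 <= n%:R * s t ^+ 2) ->
  S b - S a <= pi ->
  n%:R * cos (S b - S a) <= frob_inner (expi (f a) *: g a) (expi (f b) *: g b).
Proof.
move=> n0 ab Dg Df DS s0 gSU speed Sab.
have n0' : 0 < n%:R :> R by rewrite ltr0n.
pose h t := expi (f t) *: g t.
pose dh t := expi (f t) *: (dg t + (0 +i* df t)%C *: g t).
(* Scaling by r carries the sphere of radius sqrt n to the unit sphere. *)
pose r : R := (Num.sqrt n%:R)^-1.
have r2 : r ^+ 2 = n%:R^-1 by rewrite exprVn sqr_sqrtr // ltW.
have := @sphere_curve_ge_cos R _ (fun k t => r * crd (h t) k) (fun k t => r * crd (dh t) k)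
  S s a b ab _ DS s0 _ _ Sab.
have innerE (A B : M) : \sum_k r * crd A k * (r * crd B k) = n%:R^-1 * frob_inner A B.
  by rewrite frob_innerE mulr_sumr; apply: eq_bigr => k _; rewrite mulrACA -expr2 r2.
have sqE (A : M) : \sum_k (r * crd A k) ^+ 2 = n%:R^-1 * frob A ^+ 2.
  by rewrite frob_sqrE mulr_sumr; apply: eq_bigr => k _; rewrite exprMn r2.
move=> H; rewrite -ler_pdivlMl // -[leRHS]/(n%:R^-1 * frob_inner (h a) (h b)) -innerE.
apply: H.
- move=> k t tab.
  have D := is_derive_crd k (is_mderive_phase (Df t tab) (Dg t tab)).
  exact: (is_deriveZ (f := fun x => crd (h x) k) r).
- move=> t tab; have [ut _] := gSU t tab.
  rewrite sqE frob_sqr frob_inner_unit ?conjc_expi ?expiK // frob_unitary //.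
  by rewrite mulVf // gt_eqF.
- move=> t tab; have tab' : a <= t <= b by case/andP: tab => /ltW -> /ltW ->.
  have [ut _] := gSU t tab'.
  rewrite sqE frob_phase_velocity //; last exact: SU_curve_trace0 tab gSU (Dg t tab').
  by rewrite ler_pdivrMl // speed.
Qed.

End MatrixCurves.

(** * Length of curves and antipodal endpoints *)

Section Length.
Variables (R : realType) (n : nat).
Local Notation M := 'M[R[i]]_n.
Local Notation mu := (@lebesgue_measure R).
Implicit Types (g : R -> M) (P Q : M).

Lemma continuous_fsum (I : finType) (f : I -> R -> R) :
  (forall k, continuous (f k)) -> continuous (fun x => \sum_k f k x).
Proof.
move=> fc x; have -> : (fun x => \sum_k f k x) = \sum_k f k.
  by apply/funext => y; rewrite fct_sumE.
elim/big_ind : _ => [|u v uc vc|k _]; [exact: cst_continuous|exact: continuousD|exact: fc].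
Qed.

Lemma velocity_is_mderive g t : C1 g -> is_mderive g t (velocity g t).
Proof.
move=> gC i j; have [dr [_ [di _]]] := gC i j.
by split; rewrite !mxE /= derive1E; apply/derivableP; [exact: dr|exact: di].
Qed.

Lemma is_mderive_velocity g t l : is_mderive g t l -> velocity g t = l.
Proof.
move=> Dg; apply/matrixP => i j; rewrite mxE; apply/eqP; rewrite eq_complex.
have [dr di] := Dg i j.
by apply/andP; split;
  rewrite /= derive1E (@derive_val _ _ _ _ _ _ _ dr, @derive_val _ _ _ _ _ _ _ di).
Qed.

Lemma continuous_speed g : C1 g -> continuous (fun t => frob (velocity g t)).
Proof.
move=> gC t; apply: (continuous_comp (f := fun t => frob_inner (velocity g t) (velocity g t))
  (g := Num.sqrt)); last exact: sqrt_continuous.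
have -> : (fun t => frob_inner (velocity g t) (velocity g t)) =
    fun t => \sum_k crd (velocity g t) k * crd (velocity g t) k.
  by apply/funext => x; rewrite frob_innerE.
apply: continuous_fsum => k {}t.
suff c : {for t, continuous (fun t => crd (velocity g t) k)} by exact: continuousM.
have [_ [cr [_ ci]]] := gC k.1.1 k.1.2.
rewrite /crd; case: (k.2).
  by have -> : (fun t => complex.Re (velocity g t k.1.1 k.1.2)) = derive1 (reC g k.1.1 k.1.2)
    by [apply/funext => x; rewrite mxE]; exact: cr.
by have -> : (fun t => complex.Im (velocity g t k.1.1 k.1.2)) = derive1 (imC g k.1.1 k.1.2)
  by [apply/funext => x; rewrite mxE]; exact: ci.
Qed.

(** Integration starts at -1 and stays below 2, so that the primitive has two-sided derivatives at 0
    and 1 as well. *)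
Lemma primitive_of_continuous (v : R -> R) : continuous v ->
  exists2 S : R -> R, (forall t : R, 0 <= t <= 1 -> is_derive t 1 S (v t)) &
    S 1 - S 0 = Rintegral mu `[0, 1]%classic v.
Proof.
move=> vc.
have vi a b : mu.-integrable `[a, b] (EFin \o v).
  apply: continuous_compact_integrable; first exact: segment_compact.
  exact: continuous_subspaceT.
exists (fun x => Rintegral mu `[-1, x]%classic v).
  move=> t /andP[t0 t1].
  have [||D E] := @continuous_FTC1_closed R v (-1) t 2 _ (vi _ _) _ (vc t).
  - by rewrite (le_lt_trans t1) // ltr1n.
  - by rewrite (lt_le_trans _ t0) // oppr_lt0.
  by rewrite -E derive1E; exact/derivableP.
rewrite Rintegral_itvB ?bnd_simp //.
by rewrite Rintegral_itv_obnd_cbnd //; apply: integrableS (vi 0 1) => //; exact: subset_itv_oc_cc.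
Qed.

Lemma length_cst_speed g c : (forall t, 0 <= t <= 1 -> frob (velocity g t) = c) ->
  length g = c.
Proof.
move=> vc; rewrite /length (@eq_Rintegral _ _ _ _ _ (fun=> c)); last first.
  by move=> t; rewrite inE /= in_itv /=; exact: vc.
rewrite Rintegral_cst //= lebesgue_measure_itv /= lte_fin ltr01.
by rewrite -EFinB subr0 mulr1.
Qed.

Lemma length_ge0 g : 0 <= length g.
Proof. by apply: Rintegral_ge0 => t _; exact: frob_ge0. Qed.

Lemma frob_inner_sub (A B : M) : frob_inner (A - B) (A - B) =
  frob_inner A A - 2 * frob_inner A B + frob_inner B B.
Proof.
rewrite frob_innerDl !frob_innerDr !frob_innerNl !frob_innerNr (frob_innerC B A).
ring.
Qed.

(** Limit e -> 0, used to remove the regularization of the arc length in [antipodal_length_ge]. *)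
Lemma ge_of_perturbation (L B C : R) : 0 <= L ->
  (forall e, 0 < e -> C <= (L + e) ^+ 2 + B) -> C <= L ^+ 2 + B.
Proof.
move=> L0 H; rewrite leNgt; apply/negP => gap.
pose c := C - (L ^+ 2 + B); have c0 : 0 < c by rewrite subr_gt0.
have d0 : 0 < 2 * L + 2 + c by lra.
(* This e satisfies e <= 1, hence e (2 L + e) < c, which contradicts the hypothesis at e. *)
pose e := c / (2 * L + 2 + c); have e0 : 0 < e by rewrite divr_gt0.
have e1 : e <= 1 by rewrite ler_pdivrMr // mul1r; lra.
have ec : e * (2 * L + 2 + c) = c by rewrite divfK // gt_eqF.
have := H e e0; rewrite /c in ec c0 *; nra.
Qed.

(** The phase grows in proportion to the arc length. Adding e t to the arc length keeps the division
    meaningful when the length is 0. *)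
Lemma antipodal_length_ge g P Q (b : R) : (0 < n)%N -> admissible g P Q ->
  expi b *: Q = - P -> n%:R * pi ^+ 2 <= length g ^+ 2 + n%:R * b ^+ 2.
Proof.
move=> n0 [gC [gSU [g0 g1]]] bQ.
have n0' : 0 < n%:R :> R by rewrite ltr0n.
have pi0 := pi_gt0 R.
have [uP _] : SU P by rewrite -g0; apply: gSU; rewrite lexx ler01.
apply: ge_of_perturbation => [|e e0]; first exact: length_ge0.
pose v (t : R) := frob (velocity g t).
have [S DS S01] := primitive_of_continuous (continuous_speed gC).
set L := length g; have {}S01 : S 1 - S 0 = L by [].
have L0 : 0 <= L by exact: length_ge0.
have Le : 0 < L + e by rewrite ltr_wpDl.
(* Chosen so that n w (L + e)^2 = (L + e)^2 + n b^2: its root [kap] converts the regularized speed v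
   + e into an angular speed bounding that of the rotated curve. *)
pose w := n%:R^-1 * (1 + n%:R * b ^+ 2 / (L + e) ^+ 2).
have w0 : 0 < w.
  rewrite mulr_gt0 ?invr_gt0 //; apply: ltr_wpDr => //.
  apply: divr_ge0; last exact: sqr_ge0.
  by apply: mulr_ge0; [exact: ler0n|exact: sqr_ge0].
pose kap := Num.sqrt w.
have kap2 : kap ^+ 2 = w by rewrite sqr_sqrtr // ltW.
have kap0 : 0 < kap by rewrite sqrtr_gt0.
pose f (t : R) : R := b / (L + e) * (S t + e * t - S 0).
pose T (t : R) : R := kap * (S t + e * t).
have DSe (t : R) : 0 <= t <= 1 -> is_derive t 1 (fun x => S x + e * x) (v t + e).
  move=> t01; have D := DS t t01.
  apply: is_derive_eq (is_deriveD (f := S) (g := fun x => e * x) D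
    (is_deriveZ (f := id) e (is_derive_id t 1))) _.
  by rewrite /GRing.scale /= mulr1.
have Df (t : R) : 0 <= t <= 1 -> is_derive t 1 f (b / (L + e) * (v t + e)).
  move=> t01; have D := DSe t t01.
  apply: is_derive_eq (is_deriveZ (f := fun x => S x + e * x - S 0) (b / (L + e))
    (is_deriveB (f := fun x => S x + e * x) (g := cst (S 0)) D (is_derive_cst (S 0) t 1))) _.
  by rewrite subr0.
have DT (t : R) : 0 <= t <= 1 -> is_derive t 1 T (kap * (v t + e)).
  by move=> t01; have D := DSe t t01; exact: (is_deriveZ (f := fun x => S x + e * x) kap).
have T01 : T 1 - T 0 = kap * (L + e).
  rewrite /T -mulrBr; congr (_ * _); rewrite -S01; ring.
have T2 : n%:R * (T 1 - T 0) ^+ 2 = (L + e) ^+ 2 + n%:R * b ^+ 2.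
  rewrite T01 exprMn kap2 /w; field.
  by rewrite !gt_eqF.
(* A total angle below pi would keep the inner product of the endpoints above -n, but the endpoints
   P and -P have inner product exactly -n. *)
rewrite -T2 ler_pM2l // leNgt; apply/negP => Tpi.
have Tge0 : 0 <= T 1 - T 0 by rewrite T01 mulr_ge0 // ltW.
have {}Tpi : T 1 - T 0 < pi.
  by rewrite -(@ltr_pXn2r _ 2) ?nnegrE // ltW.
have := @phase_curve_ge_cos R n g (velocity g) f (fun t => b / (L + e) * (v t + e)) T
  (fun t => kap * (v t + e)) 0 1 n0 ler01 _ Df DT _ gSU _ (ltW Tpi).
have f0 : f 0 = 0 by rewrite /f mulr0 addr0 subrr mulr0.
have f1 : f 1 = b.
  rewrite /f mulr1 addrAC S01 divfK // gt_eqF //.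
rewrite f0 f1 expi0 scale1r g0 g1 bQ frob_innerNr frob_unitary // => H.
have : n%:R * cos (T 1 - T 0) <= - n%:R.
  apply: H.
  - by move=> t _; exact: velocity_is_mderive.
  - by move=> t _; rewrite mulr_ge0 ?addr_ge0 ?frob_ge0 // ltW.
  move=> t _; rewrite [(kap * _) ^+ 2]exprMn kap2 /w -(mulrA n%:R^-1) mulVKf ?gt_eqF //.
  rewrite mulrDl mul1r lerD //.
    by rewrite ler_pXn2r ?nnegrE ?addr_ge0 ?frob_ge0 ?(ltW e0) // lerDl ltW.
  by rewrite !exprMn exprVn !mulrA.
rewrite -mulrN1 ler_pM2l // leNgt -cospi ltr_cos ?Tpi // in_itv /= ?Tge0 ?lexx ?ltW //.
Qed.

(* The rotated curve joins antipodal points of the sphere by an arc of minimal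
   length, hence it is a great circle. *)
Lemma antipodal_minimizer g P Q (b D : R) : (0 < n)%N -> admissible g P Q ->
  expi b *: Q = - P -> (forall t, 0 <= t <= 1 -> frob (velocity g t) = D) ->
  D ^+ 2 + n%:R * b ^+ 2 = n%:R * pi ^+ 2 ->
  exists q : M, forall t, 0 <= t <= 1 ->
    expi (b * t) *: g t = (cos (pi * t))%:C%C *: P + (sin (pi * t))%:C%C *: q.
Proof.
move=> n0 [gC [gSU [g0 g1]]] bQ speed DE.
have n0' : 0 < n%:R :> R by rewrite ltr0n.
have pi0 := pi_gt0 R.
pose h (t : R) := expi (b * t) *: g t.
have h0 : h 0 = P by rewrite /h mulr0 expi0 scale1r g0.
have h1 : h 1 = - P by rewrite /h mulr1 g1 bQ.
(* Each sub-arc turns by an angle of at most pi (t - s). *)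
have hh (s t : R) : 0 <= s -> s <= t -> t <= 1 ->
    n%:R * cos (pi * (t - s)) <= frob_inner (h s) (h t).
  move=> s0 st t1.
  have sub (x : R) : s <= x <= t -> 0 <= x <= 1.
    by move=> /andP[sx xt]; rewrite (le_trans s0) // (le_trans xt).
  have Dlin (c x : R) : is_derive x 1 (fun y => c * y) c.
    apply: is_derive_eq (is_deriveZ (f := id) c (is_derive_id x 1)) _.
    by rewrite /GRing.scale /= mulr1.
  have := @phase_curve_ge_cos R n g (velocity g) (fun x => b * x) (fun=> b)
    (fun x => pi * x) (fun=> pi) s t n0 st _ (fun x _ => Dlin b x) (fun x _ => Dlin pi x).
  rewrite -mulrBr; apply.
  - by move=> x _; exact: velocity_is_mderive.
  - by move=> x _; exact: ltW.
  - by move=> x /sub; exact: gSU.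
  - move=> x /andP[/ltW sx /ltW xt].
    by rewrite speed ?DE // sub // sx.
  by rewrite ler_piMr ?(ltW pi0) //; lra.
have hn (t : R) : 0 <= t <= 1 -> frob_inner (h t) (h t) = n%:R.
  move=> /gSU[ut _].
  by rewrite frob_inner_unit ?conjc_expi ?expiK // frob_unitary.
(* The bound from the start P and the bound to the end -P pinch the inner product with P. *)
have hP (t : R) : 0 <= t <= 1 -> frob_inner (h t) P = n%:R * cos (pi * t).
  move=> /andP[t0 t1]; apply/eqP; rewrite eq_le; apply/andP; split.
    have := hh t 1 t0 t1 (lexx 1).
    by rewrite h1 frob_innerNr mulrBr mulr1 cosB cospi sinpi mul0r addr0 mulN1r mulrN lerN2.
  by have := hh 0 t (lexx 0) t0 t1; rewrite h0 subr0 frob_innerC.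
have half : 0 <= (2^-1 : R) <= 1 by apply/andP; split; lra.
(* The midpoint is orthogonal to P and serves as the second axis of the great circle. *)
pose q := h 2^-1.
have Pq : frob_inner P q = 0.
  by rewrite frob_innerC hP // cos_pihalf mulr0.
have hq (t : R) : 0 <= t <= 1 -> n%:R * sin (pi * t) <= frob_inner (h t) q.
  move=> /andP[t0 t1]; rewrite -cosBpihalf -mulrBr.
  case/andP: half => half0 half1.
  have [le|/ltW le] := leP t 2^-1.
    have := hh t 2^-1 t0 le half1.
    by rewrite -opprB mulrN cosN.
  by rewrite frob_innerC; exact: (hh 2^-1 t half0 le t1).
exists q => t t01; apply/eqP; rewrite -subr_eq0; apply/eqP/frob_eq0.
set c := cos (pi * t); set sn := sin (pi * t); rewrite -/(h t).
set z := c%:C%C *: P + sn%:C%C *: q.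
have hz : frob_inner (h t) z = c * (n%:R * c) + sn * frob_inner (h t) q.
  by rewrite frob_innerDr !frob_innerZr hP.
have qP : frob_inner q P = 0 by rewrite frob_innerC.
have cs : c ^+ 2 + sn ^+ 2 = 1 by exact: cos2Dsin2.
have zz : frob_inner z z = n%:R.
  rewrite /z !(frob_innerDl, frob_innerDr) !(frob_innerZl, frob_innerZr) Pq qP.
  rewrite -{1}h0 -{1}h0 !hn ?lexx ?ler01 // -[RHS]mulr1 -cs.
  ring.
have sn0 : 0 <= sn.
  case/andP: t01 => t0 t1; apply: sin_ge0_pi; apply/andP; split.
    by rewrite mulr_ge0 // ltW.
  by rewrite ler_piMr // ltW.
(* Both h t and z have squared norm n, and their inner product is at least n, so their distance is
   0. *)
apply/eqP; rewrite eq_le frob_inner_ge0 andbT frob_inner_sub zz hn // hz.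
have : sn * (n%:R * sn) <= sn * frob_inner (h t) q by rewrite ler_wpM2l // hq.
have : n%:R * c ^+ 2 + n%:R * sn ^+ 2 = n%:R by rewrite -mulrDr cs mulr1.
by move: (frob_inner _ _) => y; clear => ? ?; lra.
Qed.

End Length.

(** * Choice of eigenvalue arguments and bound on their sum of squares *)

Section Phases.
Variable R : realType.

(* The parabola at m for [s + x] is, up to [x (1 - x)], the convex combination with
   weights 1 - x, x of the parabolas at m and m - 1 for s. *)
Lemma sum_parabola_ge (I : Type) (r : seq I) (x : I -> R) (m : int) :
  (forall k, 0 <= x k <= 1) ->
  let s := \sum_(k <- r) x k in
  (s - m%:~R) * (m%:~R + 1 - s) <= \sum_(k <- r) x k * (1 - x k).
Proof.
move=> x01; elim: r m => [|k r IH] m /=; rewrite ?big_nil ?big_cons.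
  rewrite sub0r subr0 mulNr oppr_le0.
  (* No integer lies strictly between -1 and 0. *)
  suff : (0 : int) <= m * (m + 1) by rewrite -(ler_int R) rmorphM rmorphD.
  case: m => m.
    by rewrite mulr_ge0.
  by rewrite NegzE -mulrNN mulr_ge0 // ?opprK // opprD opprK -addn1 PoszD addrK.
have := IH m; have := IH (m - 1); rewrite /= rmorphB /=.
move: (\sum_(j <- r) x j) (\sum_(j <- r) x j * (1 - x j)) => s q h1 h0.
have /andP[xk0 xk1] := x01 k.
have := ler_wpM2l xk0 h1; have xk1' : 0 <= 1 - x k by lra.
have := ler_wpM2l xk1' h0; nra.
Qed.

(** Greedy choice of a largest remaining element; it selects the arguments to be lowered by 2 pi. *)
Lemma top_subset (I : finType) (x : I -> R) (m : nat) : (m <= #|I|)%N ->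
  exists2 T : {set I}, #|T| = m & forall i j, i \in T -> j \notin T -> x j <= x i.
Proof.
elim: m => [|m IH] mI; first by exists finset.set0; [rewrite cards0|move=> i j; rewrite inE].
have [T Tm Ttop] := IH (ltnW mI).
have /set0Pn[i0 i0T] : ~: T != finset.set0.
  by rewrite -card_gt0 cardsCs finset.setCK Tm subn_gt0.
have [i1] := @arg_maxP _ _ I i0 (fun i => i \in ~: T) x i0T.
rewrite inE => iT imax.
exists (i1 |: T); first by rewrite cardsU1 iT Tm.
move=> a b; rewrite !inE negb_or => /orP[/eqP ->|aT] /andP[_ bT]; last exact: Ttop.
by apply: imax; rewrite inE.
Qed.

(** With B the sum of the x (1 - x) and v = (s - n/2)^2, one has V = n/4 - B - v/n. If v >= o/4 the
    bound is immediate. Otherwise n is odd and s is within 1/2 of n/2, where [sum_parabola_ge]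
    forces B to be large and the bound is strict. *)
Lemma centered_variance_le (n : nat) (x : 'I_n -> R) : (2 <= n)%N ->
  (forall k, 0 <= x k <= 1) ->
  let s := \sum_k x k in let V := \sum_k x k ^+ 2 - s ^+ 2 / n%:R in
  let o : R := (odd n)%:R in
  V <= (n%:R - o / n%:R) / 4 /\
  (V = (n%:R - o / n%:R) / 4 ->
    (s - n%:R / 2) ^+ 2 = o / 4 /\ forall k, x k * (1 - x k) = 0).
Proof.
move=> n2 x01 s V o.
have n0 : 0 < n%:R :> R by rewrite ltr0n (leq_trans _ n2).
pose N : R := n%:R; pose B := \sum_k x k * (1 - x k); pose v := (s - N / 2) ^+ 2.
have xB k : 0 <= x k * (1 - x k).
  by have /andP[? ?] := x01 k; rewrite mulr_ge0 // subr_ge0.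
have B0 : 0 <= B by apply: sumr_ge0 => k _; exact: xB.
have VE : V = (N / 4 - B) - v / N.
  have BE : B = s - \sum_k x k ^+ 2.
    by rewrite /B -sumrB; apply: eq_bigr => k _; rewrite mulrBr mulr1.
  by rewrite /V BE /v /N; field; rewrite gt_eqF.
have fin : v = o / 4 -> B = 0 -> v = o / 4 /\ forall k, x k * (1 - x k) = 0.
  move=> vo /eqP; rewrite psumr_eq0 // => /allP Bk; split=> // k.
  exact/eqP/Bk/mem_index_enum.
have v0 : 0 <= v by exact: sqr_ge0.
have bnd : (N - o / N) / 4 = N / 4 - (o / 4) / N by field; rewrite gt_eqF.
have big : o / 4 <= v -> V <= (N - o / N) / 4 /\ (V = (N - o / N) / 4 ->
    v = o / 4 /\ forall k, x k * (1 - x k) = 0).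
  move=> ov; have vN : (o / 4) / N <= v / N by rewrite ler_pM2r ?invr_gt0.
  split=> [|E]; first by lra.
  have B00 : B = 0 by lra.
  have vN' : v / N = (o / 4) / N by lra.
  by apply: fin => //; apply: (mulIf _ vN'); rewrite invr_neq0 // gt_eqF.
have [/big//|vo] := leP (o / 4) v.
have oE : o = 1 by move: vo; rewrite /o; case: (odd n) => //; rewrite mul0r ltNge v0.
have nE : N = 1 + 2 * (n./2)%:R.
  rewrite /N -{1}(odd_double_half n) natrD -/o oE -mul2n natrM //.
have := @sum_parabola_ge _ (index_enum _) x (n./2) x01.
rewrite -/s -/B /= => Bge.
suff Vlt : V < (N - o / N) / 4 by split=> [|E]; [exact: ltW|move: Vlt; rewrite -/N E ltxx].
(* For m = (n - 1)/2 the parabola (s - m) (m + 1 - s) equals 1/4 - v. *)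
have Bge' : 1 / 4 - v <= B.
  apply: le_trans Bge; rewrite /v le_eqVlt; apply/orP; left; apply/eqP.
  have -> : (n./2)%:~R = (N - 1) / 2 :> R by rewrite -pmulrn nE; field.
  by field.
have N1 : 1 < N by rewrite /N ltr1n.
rewrite bnd VE oE in vo *.
(* This product is a lower bound for the gap between V and its announced maximum. *)
have : 0 < (1 / 4 - v) * (1 - N^-1).
  by rewrite mulr_gt0 ?subr_gt0 // invf_lt1.
nra.
Qed.

(** Arguments in [0, 2 pi) have a sum 2 pi m; lowering the m largest by 2 pi makes the sum zero and
    keeps the spread at most 2 pi. Rescaled to [0, 1], they fall under [centered_variance_le]. *)
Lemma zero_sum_phases (n : nat) (lam : 'I_n -> R[i]) : (2 <= n)%N ->
  (forall k, lam k * ((lam k)^*)%C = 1) -> \prod_k lam k = 1 ->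
  let o : R := (odd n)%:R in
  exists th : 'I_n -> R, [/\ forall k, lam k = expi (th k), \sum_k th k = 0,
    \sum_k th k ^+ 2 <= (n%:R - o / n%:R) * pi ^+ 2 &
    \sum_k th k ^+ 2 = (n%:R - o / n%:R) * pi ^+ 2 ->
    exists e : bool, forall k, lam k = expi ((-1) ^+ e * (pi - o * pi / n%:R))].
Proof.
move=> n2 lam1 plam o.
have n0 : 0 < n%:R :> R by rewrite ltr0n (leq_trans _ n2).
have pi0 := pi_gt0 R.
have [t0 t0P] : exists t0 : 'I_n -> R, forall k, 0 <= t0 k < 2 * pi /\ lam k = expi (t0 k).
  have /boolp.choice[f fP] : forall k, exists a : R, 0 <= a < 2 * pi /\ lam k = expi a.
    by move=> k; have [a a1 a2] := expi_surj (lam1 k); exists a.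
  by exists f.
have [||m mn tm] := @expi_eq1_nat R n (\sum_k t0 k).
- apply/andP; split; first by apply: sumr_ge0 => k _; case: (t0P k) => /andP[].
  have -> : 2 * pi * n%:R = \sum_(k < n) (2 * pi) :> R.
    by rewrite sumr_const card_ord mulr_natr.
  apply: ltr_sum.
    by apply/hasP; exists (Ordinal (ltnW n2)); rewrite ?mem_index_enum.
  by move=> k _; case: (t0P k) => /andP[].
- by rewrite expi_sum -[RHS]plam; apply: eq_bigr => k _; case: (t0P k).
have [T Tm Ttop] : exists2 T : {set 'I_n}, #|T| = m &
    forall i j, i \in T -> j \notin T -> t0 j <= t0 i.
  by apply: top_subset; rewrite card_ord ltnW.
pose th k := t0 k - 2 * pi * (k \in T)%:R.
have thl k : lam k = expi (th k).
  case: (t0P k) => _ ->; rewrite /th; case: (k \in T); last by rewrite mulr0 subr0.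
  by rewrite mulr1 expiD /expi cosN sinN mulr_natl cos2pi sin2pi oppr0 mulr1.
have th0 : \sum_k th k = 0.
  rewrite sumrB tm -mulr_sumr -natr_sum -big_mkcond /= sum1_card Tm subrr //.
have spread i j : th i <= th j + 2 * pi.
  rewrite /th; case: (t0P i) => /andP[i0 i1] _; case: (t0P j) => /andP[j0 j1] _.
  case: (boolP (i \in T)) => iT; case: (boolP (j \in T)) => jT; rewrite ?mulr1 ?mulr0; try lra.
  have := Ttop j i jT iT; lra.
have [i0 _ i0min] := @arg_minP _ _ 'I_n (Ordinal (ltnW n2)) xpredT th isT.
(* Shift by the minimum and divide by 2 pi: the spread bound places every x in [0, 1]. *)
pose a := th i0 / (2 * pi); pose x k := th k / (2 * pi) - a.
have pi2 : 0 < 2 * pi :> R by lra.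
have x01 k : 0 <= x k <= 1.
  rewrite /x /a -mulrBl; apply/andP; split.
    by rewrite divr_ge0 ?(ltW pi2) // subr_ge0 i0min.
  by rewrite ler_pdivrMr // mul1r; have := spread k i0; lra.
have thx k : th k = 2 * pi * (x k + a) by rewrite /x subrK mulrCA divff ?mulr1 // gt_eqF.
have sa : \sum_k x k = - (n%:R * a).
  move: th0; rewrite (eq_bigr _ (fun k _ => thx k)) -mulr_sumr => /eqP.
  rewrite mulf_eq0 gt_eqF //= big_split /= sumr_const card_ord mulr_natl addr_eq0.
  by move/eqP.
have sqE : \sum_k th k ^+ 2 =
    4 * pi ^+ 2 * (\sum_k x k ^+ 2 - (\sum_k x k) ^+ 2 / n%:R).
  transitivity (4 * pi ^+ 2 * (\sum_k x k ^+ 2 + 2 * a * \sum_k x k + n%:R * a ^+ 2)).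
    have -> : n%:R * a ^+ 2 = \sum_(k < n) a ^+ 2 by rewrite sumr_const card_ord mulr_natl.
    rewrite [2 * a * _]mulr_sumr -!big_split [RHS]mulr_sumr.
    by apply: eq_bigr => k _ /=; rewrite thx; ring.
  by rewrite sa; field; rewrite gt_eqF.
have /= [Vle Veq] := centered_variance_le n2 x01.
rewrite -/o in Vle Veq.
move: Vle Veq sqE; set V := _ - _ => Vle Veq sqE.
have pp : 0 < 4 * pi ^+ 2 :> R by rewrite mulr_gt0 // exprn_gt0.
have bE : (n%:R - o / n%:R) * pi ^+ 2 = 4 * pi ^+ 2 * ((n%:R - o / n%:R) / 4).
  by field; rewrite gt_eqF.
exists th; split=> //; first by rewrite sqE bE ler_pM2l.
rewrite sqE bE => E.
have {}E : V = (n%:R - o / n%:R) / 4 by apply: (mulfI _ E); rewrite gt_eqF.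
have [sE xE] := Veq E.
(* In the equality case each x is 0 or 1, that is, all angles agree modulo 2 pi. *)
have lamE k : lam k = expi (2 * pi * a).
  have /eqP := xE k; rewrite mulf_eq0 => /orP[/eqP xk|/eqP xk]; rewrite thl thx.
    by rewrite xk add0r.
  have -> : x k = 1 by move: xk; lra.
  by rewrite mulrDr mulr1 expiD /expi mulr_natl cos2pi sin2pi mul1r.
have o2 : o ^+ 2 = o by rewrite /o; case: (odd n); rewrite ?expr1n ?expr0n.
have aE : a = - ((\sum_k x k) / n%:R) by rewrite sa; field; rewrite gt_eqF.
(* As o = o^2, the sum of the x is (n + o)/2 or (n - o)/2, which yields the two signs of the
   angle. *)
have : ((\sum_k x k) - n%:R / 2 - o / 2) * ((\sum_k x k) - n%:R / 2 + o / 2) = 0.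
  by rewrite -subr_sqr sE exprMn o2; field.
move/eqP; rewrite mulf_eq0 => /orP[]/eqP sx.
  exists false => k; rewrite lamE expr0 mul1r.
  have -> : pi - o * pi / n%:R = 2 * pi + 2 * pi * a.
    have -> : a = - ((n%:R / 2 + o / 2) / n%:R) by rewrite aE; congr (- (_ / _)); lra.
    by field; rewrite gt_eqF.
  by rewrite [RHS]expiD [expi (2 * pi)]/expi mulr_natl cos2pi sin2pi mul1r.
exists true => k; rewrite lamE expr1 mulN1r; congr expi.
have -> : a = - ((n%:R / 2 - o / 2) / n%:R) by rewrite aE; congr (- (_ / _)); lra.
by field; rewrite gt_eqF.
Qed.

End Phases.

(** * Diagonalization and curves with diagonal exponents *)

Section SpectralTheorem.
Variables (R : realType) (n : nat).
Local Notation M := 'M[R[i]]_n.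
Implicit Types (A B P V X : M) (d : 'rV[R[i]]_n).

Lemma normal_diagonalizable A : A *m adj A = adj A *m A ->
  exists V d, V *m adj V = 1%:M /\ A = adj V *m diag_mx d *m V.
Proof.
have adjE (B : M) : adj B = map_mx Num.conj (B^T).
  by apply/matrixP => i j; rewrite !mxE.
move=> nA; have /orthomx_spectralP AE : A \is normalmx.
  by apply/normalmxP; rewrite -!adjE.
have uV := spectral_unitarymx A.
move: (spectralmx A) (spectral_diag A) uV AE => V d uV AE.
exists V, d; rewrite adjE; split; first exact/unitarymxP.
by rewrite -invmx_unitary.
Qed.

Lemma diag_of_conj V d A : V *m adj V = 1%:M -> A = adj V *m diag_mx d *m V ->
  diag_mx d = V *m A *m adj V.
Proof.
move=> uV ->; rewrite !mulmxA uV mul1mx -mulmxA uV mulmx1 //.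
Qed.

Lemma diag_mx_inj d e : diag_mx d = diag_mx e -> d = e.
Proof.
move=> /matrixP de; apply/rowP => k; have := de k k.
by rewrite !mxE eqxx !mulr1n.
Qed.

Lemma det_conj_diag V d : V *m adj V = 1%:M ->
  \det (adj V *m diag_mx d *m V) = \prod_k d 0 k.
Proof.
move=> uV; rewrite !det_mulmx mulrAC -det_mulmx unitary_comm // det1 mul1r.
exact: det_diag.
Qed.

Lemma unitary_diagonalizable A : A *m adj A = 1%:M ->
  exists V d, [/\ V *m adj V = 1%:M, A = adj V *m diag_mx d *m V &
    forall k, d 0 k * ((d 0 k)^*)%C = 1].
Proof.
move=> uA; have [|V [d [uV AE]]] := @normal_diagonalizable A.
  by rewrite uA unitary_comm.
exists V, d; split=> // k.
have E : diag_mx d *m adj (diag_mx d) = 1%:M.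
  rewrite (diag_of_conj uV AE); apply: unitaryM; first exact: unitaryM.
  by rewrite adjmxK unitary_comm.
have /matrixP/(_ k k) := E.
by rewrite adjmx_diag mulmx_diag !mxE eqxx mulr1n.
Qed.

Lemma rank_diag01_le d : (forall k, d 0 k = 0 \/ d 0 k = 1) ->
  (\rank (diag_mx d) <= \sum_k (d 0%R k != 0%R))%N.
Proof.
move=> d01; rewrite diag_mx_sum_delta.
elim/big_ind2 : _ => [|A r B s Ar Bs|k _]; first by rewrite mxrank0.
  by apply: leq_trans (mxrank_add _ _) _; rewrite leq_add.
have [->|dk] := eqVneq (d 0 k) 0; first by rewrite scale0r mxrank0.
by rewrite mxrank_scale_nz // mxrank_delta.
Qed.

Lemma projection_diagonalizable X : adj X = X -> X *m X = X ->
  exists V d, [/\ V *m adj V = 1%:M, X = adj V *m diag_mx d *m V,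
    forall k, d 0 k = 0 \/ d 0 k = 1 & \rank X = (\sum_k (d 0%R k != 0%R))%N].
Proof.
move=> hX iX; have [|V [d [uV XE]]] := @normal_diagonalizable X; first by rewrite hX.
have dE := diag_of_conj uV XE.
have d01 k : d 0 k = 0 \/ d 0 k = 1.
  have : diag_mx d *m diag_mx d = diag_mx d.
    rewrite dE; transitivity (V *m (X *m (adj V *m V) *m X) *m adj V); first by rewrite !mulmxA.
    by rewrite unitary_comm // mulmx1 iX.
  rewrite mulmx_diag => /diag_mx_inj /rowP /(_ k); rewrite mxE => /eqP.
  rewrite -subr_eq0 -{3}[d 0 k]mulr1 -mulrBr mulf_eq0 subr_eq0.
  by move=> /orP[]/eqP; [left|right].
exists V, d; split=> //.
have uV' := unitary_comm uV.
have rV : row_free V by rewrite row_free_unit; case/mulmx1_unit : uV.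
have rV' : row_full (adj V) by rewrite row_full_unit; case/mulmx1_unit : uV.
have -> : \rank X = \rank (diag_mx d).
  by rewrite XE mxrankMfree // eqmxMfull.
apply/eqP; rewrite eqn_leq rank_diag01_le //=.
(* The reverse bound uses the complement 1 - d: the two ranks add up to at least n, while the two
   counts that bound them add up to exactly n. *)
pose e : 'rV[R[i]]_n := \row_k (1 - d 0 k).
have e01 k : e 0 k = 0 \/ e 0 k = 1.
  by rewrite mxE; case: (d01 k) => ->; rewrite ?subr0 ?subrr; [right|left].
have de : diag_mx d + diag_mx e = 1%:M.
  apply/matrixP => i j; rewrite !mxE -mulrnDl addrC subrK //.
have : (n <= \rank (diag_mx d) + \sum_k (e 0%R k != 0%R))%N.
  rewrite -{1}(mxrank1 (R[i]) n) -de; apply: leq_trans (mxrank_add _ _) _.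
  by rewrite leq_add2l rank_diag01_le.
have : (\sum_k (d 0%R k != 0%R) + \sum_k (e 0%R k != 0%R) = n)%N.
  rewrite -big_split /= -[RHS]card_ord -sum1_card; apply: eq_bigr => k _.
  by rewrite mxE; case: (d01 k) => ->; rewrite ?subr0 ?subrr ?eqxx ?oner_eq0.
move: (\sum_k _)%N (\sum_k _)%N (\rank _) => a b r; lia.
Qed.

(* The weights c make the family closed under differentiation. *)
Definition diag_curve A B (c : 'I_n -> R[i]) (th : 'I_n -> R) (t : R) : M :=
  A *m diag_mx (\row_k (c k * expi (th k * t))) *m B.

Lemma is_mderive_diag_curve A B c th t :
  is_mderive (diag_curve A B c th) t
    (diag_curve A B (fun k => c k * (0 +i* th k)%C) th t).
Proof.
apply: is_mderiveMr; apply: is_mderiveMl => i j; rewrite !mxE.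
have [<-|ij] := eqVneq i j; last first.
  have -> : (fun x => (diag_mx (\row_k (c k * expi (th k * x))) : M) i j) = fun=> 0.
    by apply/funext => x; rewrite !mxE (negPf ij) mulr0n.
  by rewrite mulr0n; exact: is_cderive_cst.
have -> : (fun x => (diag_mx (\row_k (c k * expi (th k * x))) : M) i i) =
    fun x => c i * expi (th i * x).
  by apply/funext => x; rewrite !mxE eqxx mulr1n.
have D : is_derive t 1 (fun x => th i * x) (th i).
  apply: is_derive_eq (is_deriveZ (f := id) (th i) (is_derive_id t 1)) _.
  by rewrite /GRing.scale /= mulr1.
have := is_cderiveM (is_cderive_cst (c i) t) (is_cderive_expi D).
by rewrite mul0r add0r mulr1n mulrA.
Qed.

(** A second derivative makes the first one continuous. *)
Lemma C1_of_mderive (g dg ddg : R -> M) : (forall t, is_mderive g t (dg t)) ->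
  (forall t, is_mderive dg t (ddg t)) -> C1 g.
Proof.
move=> Dg Ddg i j.
have cont (f df : R -> R) : (forall t : R, is_derive t 1 f (df t)) -> continuous f.
  move=> Df t; apply/differentiable_continuous/derivable1_diffP.
  by have D := Df t; exact: ex_derive.
have dr : derive1 (reC g i j) = fun t => complex.Re (dg t i j).
  by apply/funext => t; have [D _] := Dg t i j; rewrite derive1E (@derive_val _ _ _ _ _ _ _ D).
have di : derive1 (imC g i j) = fun t => complex.Im (dg t i j).
  by apply/funext => t; have [_ D] := Dg t i j; rewrite derive1E (@derive_val _ _ _ _ _ _ _ D).
split; first by move=> t; have [D _] := Dg t i j; exact: ex_derive.
split; first by rewrite dr; apply: cont => t; have [D _] := Ddg t i j; exact: D.
split; first by move=> t; have [_ D] := Dg t i j; exact: ex_derive.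
by rewrite di; apply: cont => t; have [_ D] := Ddg t i j; exact: D.
Qed.

(** The curve is P exp (t V^* diag (i th) V). The zero sum keeps the determinant equal to 1, and
    unitary factors do not change the speed. *)
Lemma diag_curve_admissible P V (th : 'I_n -> R) : SU P -> V *m adj V = 1%:M ->
  \sum_k th k = 0 ->
  let g := diag_curve (P *m adj V) V (fun=> 1) th in
  admissible g P (P *m (adj V *m diag_mx (\row_k expi (th k)) *m V)) /\
  forall t, frob (velocity g t) = Num.sqrt (\sum_k th k ^+ 2).
Proof.
move=> [uP dP] uV th0 g; have uV' := unitary_comm uV.
have Dg t := is_mderive_diag_curve (P *m adj V) V (fun=> 1) th t.
have gE t : g t = P *m (adj V *m diag_mx (\row_k expi (th k * t)) *m V).
  rewrite /g /diag_curve !mulmxA; congr (_ *m diag_mx _ *m _).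
  by apply/rowP => k; rewrite !mxE mul1r.
have uaV : adj V *m adj (adj V) = 1%:M by rewrite adjmxK.
have uPV := unitaryM uP uaV.
have udiag t : diag_mx (\row_k expi (th k * t)) *m adj (diag_mx (\row_k expi (th k * t)))
    = 1%:M :> M.
  rewrite adjmx_diag mulmx_diag; apply/matrixP => i j; rewrite !mxE (@conjc_expi R) expiK.
  by [].
have conjM (z w : R[i]) : ((z * w)^*)%C = (z^*)%C * (w^*)%C := rmorphM conjc z w.
split; last first.
  move=> t; rewrite (is_mderive_velocity (Dg t)) /diag_curve frob_mulr // frob_mul //.
  rewrite /frob frob_diag; congr Num.sqrt; apply: eq_bigr => k _; rewrite !mxE mul1r.
  rewrite conjM (@conjc_expi R) mulrACA expiK mulr1 /=.
  by rewrite mul0r mulrN sub0r opprK expr2.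
split; first exact: C1_of_mderive Dg (fun t => is_mderive_diag_curve _ _ _ _ t).
split.
  move=> t _; rewrite gE; split.
    exact: unitaryM uP (unitaryM (unitaryM uaV (udiag t)) uV).
  rewrite det_mulmx dP mul1r det_conj_diag // (eq_bigr (fun k => expi (th k * t))).
    by rewrite -expi_sum -mulr_suml th0 mul0r expi0.
  by move=> k _; rewrite mxE.
rewrite !gE; split; last first.
  have -> // : \row_k expi (th k * 1) = \row_k expi (th k).
  by apply/rowP => k; rewrite !mxE mulr1.
have -> : diag_mx (\row_k expi (th k * 0)) = 1%:M :> M.
  by apply/matrixP => i j; rewrite !mxE mulr0 expi0.
by rewrite mulmx1 uV' mulmx1.
Qed.

End SpectralTheorem.

(** * Distance, diameter and diametral points *)

Section Distance.
Variables (R : realType) (n : nat).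
Local Notation M := 'M[R[i]]_n.
Implicit Types (P Q X Y : M).

Lemma dist_le_length (g : R -> M) P Q : admissible g P Q -> dist P Q <= length g.
Proof.
move=> ag; apply: ge_inf; last by exists g.
by exists 0 => _ [h [_ ->]]; exact: length_ge0.
Qed.

(** The existence of a curve rules out the infimum of the empty set, which has a default value. *)
Lemma dist_ge (c : R) P Q : (exists g : R -> M, admissible g P Q) ->
  (forall g : R -> M, admissible g P Q -> c <= length g) -> c <= dist P Q.
Proof.
move=> [g ag] H; apply: lb_le_inf; first by exists (length g), g.
by move=> _ [h [ah ->]]; exact: H.
Qed.

Hypothesis n2 : (2 <= n)%N.
Local Notation o := ((odd n)%:R : R).

Let n0 : (0 < n)%N. Proof. exact: ltnW. Qed.
Let N0 : 0 < n%:R :> R. Proof. by rewrite ltr0n. Qed.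
Let o2 : o ^+ 2 = o. Proof. by case: (odd n); rewrite ?expr1n ?expr0n. Qed.
Let nE : n%:R = 2 * (n./2)%:R + o :> R.
Proof. by rewrite -{1}(odd_double_half n) natrD addrC -mul2n natrM. Qed.

(** The parity [o], read as a real number, lets one formula cover even and odd n. *)
Definition diam_value : R := Num.sqrt (n%:R - o / n%:R) * pi.
Definition sgn (e : bool) : R := (-1) ^+ e.
(** The phase of a diametral point: a sign times pi for even n, times (n - 1) pi / n for odd n. The
    [central_angle] completes it to that sign times pi and is the phase rotating the endpoint to
    -P. *)
Definition diam_angle (e : bool) : R := sgn e * (pi - o * pi / n%:R).
Definition central_angle (e : bool) : R := sgn e * (o * pi / n%:R).

Let sgn2 e : sgn e ^+ 2 = 1.
Proof. by rewrite /sgn; case: e; rewrite ?expr1 ?sqrrN ?expr0 expr1n. Qed.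

Let diam_radicand_ge0 : 0 <= n%:R - o / n%:R :> R.
Proof.
have o1 : o <= 1 by case: (odd n).
have n1 : 1 <= n%:R :> R by rewrite ler1n.
rewrite subr_ge0 ler_pdivrMr //; nra.
Qed.

Lemma diam_value_ge0 : 0 <= diam_value.
Proof. by rewrite mulr_ge0 ?sqrtr_ge0 // pi_ge0. Qed.

Lemma diam_value_sqr : diam_value ^+ 2 = (n%:R - o / n%:R) * pi ^+ 2.
Proof. by rewrite exprMn sqr_sqrtr. Qed.

Lemma diam_value_central e :
  diam_value ^+ 2 + n%:R * central_angle e ^+ 2 = n%:R * pi ^+ 2.
Proof.
rewrite diam_value_sqr /central_angle exprMn sgn2 mul1r !exprMn o2.
by field; rewrite gt_eqF.
Qed.

Lemma expi_sgn_pi e : expi (sgn e * pi) = -1.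
Proof.
rewrite /sgn; case: e; rewrite ?expr1 ?expr0 ?mul1r ?expi_pi //.
by rewrite mulN1r -(@conjc_expi R) expi_pi rmorphN1.
Qed.

Lemma expi_central_diam e P : expi (central_angle e) *: (expi (diam_angle e) *: P) = - P.
Proof.
rewrite scalerA -expiD /central_angle /diam_angle -mulrDr addrC subrK expi_sgn_pi.
by rewrite scaleN1r.
Qed.

Lemma diam_angleE e : diam_angle e = sgn e * pi - central_angle e.
Proof. by rewrite /diam_angle mulrBr. Qed.

(** The exponential curve built on the eigenvalues of P^* Q with the arguments of [zero_sum_phases].
    In the equality case all eigenvalues coincide, so P^* Q is scalar. *)
Lemma short_curve P Q : SU P -> SU Q ->
  exists g : R -> M, [/\ admissible g P Q, length g <= diam_value &
    length g = diam_value -> exists e, Q = expi (diam_angle e) *: P].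
Proof.
move=> sP sQ; have [uP dP] := sP.
have [uA dA] : SU (adj P *m Q) by apply: SU_mul => //; exact: SU_adj.
have [V [d [uV AE d1]]] := unitary_diagonalizable uA.
have [|th [dth th0 thle theq]] := zero_sum_phases n2 d1.
  by rewrite -(det_conj_diag d uV) -AE.
have [ag sp] := diag_curve_admissible sP uV th0.
have dE : \row_k expi (th k) = d by apply/rowP => k; rewrite mxE dth.
have QE : P *m (adj V *m diag_mx d *m V) = Q by rewrite -AE mulmxA uP mul1mx.
rewrite dE QE in ag.
have lE := length_cst_speed (fun t _ => sp t).
exists (diag_curve (P *m adj V) V (fun=> 1) th); split=> //; rewrite lE.
  rewrite -(@ler_pXn2r _ 2) ?nnegrE ?sqrtr_ge0 ?diam_value_ge0 //.
  by rewrite diam_value_sqr sqr_sqrtr // sumr_ge0 // => k _; exact: sqr_ge0.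
move=> E; have [|e de] := theq.
  rewrite -diam_value_sqr -E sqr_sqrtr // sumr_ge0 // => k _; exact: sqr_ge0.
exists e; rewrite -QE.
have -> : diag_mx d = (expi (diam_angle e))%:M.
  by apply/matrixP => i j; rewrite !mxE de; case: eqVneq.
by rewrite mul_mx_scalar -scalemxAl unitary_comm // -scalemxAr mulmx1.
Qed.

Lemma dist_le_diam_value P Q : SU P -> SU Q -> dist P Q <= diam_value.
Proof.
move=> sP sQ; have [g [ag lg _]] := short_curve sP sQ.
exact: le_trans (dist_le_length ag) lg.
Qed.

Lemma dist_eq_diam_value P Q : SU P -> SU Q -> dist P Q = diam_value ->
  exists e, Q = expi (diam_angle e) *: P.
Proof.
move=> sP sQ dE; have [g [ag lg lE]] := short_curve sP sQ.
by apply: lE; apply/eqP; rewrite eq_le lg -dE dist_le_length.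
Qed.

Lemma expi_even (m : nat) (x : R) : expi x = -1 -> expi (2 * m%:R * x) = 1.
Proof.
move=> ex; elim: m => [|m IH]; first by rewrite mulr0 mul0r expi0.
have -> : 2 * m.+1%:R * x = 2 * m%:R * x + x + x by rewrite -(natr1 m); ring.
by rewrite !expiD IH ex mul1r mulrNN mulr1.
Qed.

Lemma SU_diam_point e P : SU P -> SU (expi (diam_angle e) *: P).
Proof.
move=> [uP dP]; split.
  by rewrite adjmxZ -scalemxAl -scalemxAr scalerA (@conjc_expi R) expiK uP scale1r.
rewrite detZ dP mulr1.
have -> : expi (diam_angle e) ^+ n = expi (\sum_(k < n) diam_angle e).
  by rewrite expi_sum prodr_const card_ord.
(* The total angle (n - o) pi is an even multiple of pi, so the determinant stays 1. *)
have -> : \sum_(k < n) diam_angle e = 2 * (n./2)%:R * (sgn e * pi).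
  rewrite sumr_const card_ord -mulr_natl /diam_angle.
  have -> : pi - o * pi / n%:R = (n%:R - o) * pi / n%:R by field; rewrite gt_eqF.
  rewrite [X in X - o]nE addrK; field; rewrite gt_eqF //.
exact/expi_even/expi_sgn_pi.
Qed.

Lemma length_ge_diam_value (g : R -> M) e P :
  admissible g P (expi (diam_angle e) *: P) -> diam_value <= length g.
Proof.
move=> ag; have := antipodal_length_ge n0 ag (expi_central_diam e P).
rewrite -(diam_value_central e) lerD2r.
by rewrite ler_pXn2r ?nnegrE ?diam_value_ge0 ?length_ge0.
Qed.

Lemma dist_diam_point e P : SU P -> dist P (expi (diam_angle e) *: P) = diam_value.
Proof.
move=> sP; have sQ := SU_diam_point e sP.
apply/eqP; rewrite eq_le dist_le_diam_value //=; apply: dist_ge.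
  by have [g [ag _ _]] := short_curve sP sQ; exists g.
by move=> g; exact: length_ge_diam_value.
Qed.

Lemma SU1 : SU (1%:M : M).
Proof. by split; rewrite ?det1 // adjmx1 mulmx1. Qed.

Lemma diamE : diam R n = diam_value.
Proof.
apply/eqP; rewrite eq_le; apply/andP; split.
  apply: ge_sup.
    exists (dist (1%:M : M) 1%:M), 1%:M, 1%:M.
    by split; [exact: SU1|split; [exact: SU1|]].
  by move=> _ [P [Q [sP [sQ ->]]]]; exact: dist_le_diam_value.
rewrite -(dist_diam_point false SU1); apply: ub_le_sup.
  by exists diam_value => _ [P [Q [sP [sQ ->]]]]; exact: dist_le_diam_value.
exists 1%:M, (expi (diam_angle false) *: 1%:M).
by split; [exact: SU1|split; [exact/SU_diam_point/SU1|]].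
Qed.

Lemma diametralP P Q : SU P -> diametral P Q <-> exists e, Q = expi (diam_angle e) *: P.
Proof.
move=> sP; rewrite /diametral diamE; split=> [[sQ dE]|[e ->]].
  exact: dist_eq_diam_value.
by split; [exact: SU_diam_point|exact: dist_diam_point].
Qed.

(** * Minimizing geodesic segments and the Grassmannian *)

(* X is the spectral projection of the logarithm for the eigenvalue of argument
   [- sgn e * pi - central_angle e]. *)
Definition geodesic (e : bool) P X (t : R) : M :=
  P *m (expi ((sgn e * pi - central_angle e) * t) *: (1%:M - X) +
        expi ((- (sgn e * pi) - central_angle e) * t) *: X).

Lemma natr_sum01 (d : 'rV[R[i]]_n) (a b : R) : (forall k, d 0 k = 0 \/ d 0 k = 1) ->
  \sum_k (if d 0 k == 0 then a else b) =
  n%:R * a + (\sum_k (d 0%R k != 0%R))%N%:R * (b - a).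
Proof.
move=> d01; rewrite natr_sum mulr_suml.
have -> : n%:R * a = \sum_(k < n) a by rewrite sumr_const card_ord mulr_natl.
rewrite -big_split; apply: eq_bigr => k _ /=.
by case: eqP => _; rewrite ?mul0r ?addr0 // mul1r addrC subrK.
Qed.

Lemma geodesic_diag e P X V d : V *m adj V = 1%:M -> X = adj V *m diag_mx d *m V ->
  (forall k, d 0 k = 0 \/ d 0 k = 1) ->
  geodesic e P X = diag_curve (P *m adj V) V (fun=> 1)
    (fun k => if d 0 k == 0 then sgn e * pi - central_angle e
              else - (sgn e * pi) - central_angle e).
Proof.
move=> uV -> d01; apply/funext => t; rewrite /geodesic /diag_curve -!mulmxA; congr (P *m _).
have {1}-> : 1%:M = adj V *m (diag_mx (const_mx 1) *m V).
  by rewrite diag_const_mx mul1mx unitary_comm.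
have pull (z : R[i]) (B : M) : z *: (adj V *m (B *m V)) = adj V *m ((z *: B) *m V).
  by rewrite -scalemxAl -scalemxAr.
rewrite -mulmxBr -mulmxBl !pull -mulmxDr -mulmxDl; congr (_ *m (_ *m _)).
apply/matrixP => i j; rewrite !mxE mul1r.
have [->|] := eqVneq i j; last by rewrite !mulr0n subrr !mulr0 addr0.
rewrite !mulr1n; case: (d01 j) => ->.
  by rewrite eqxx subr0 mulr0 mulr1 addr0.
by rewrite oner_eq0 subrr mulr0 mulr1 add0r.
Qed.

(** For rank r the angles sum to sgn e * pi * (n - o - 2 r), so r = n./2 is what makes the sum zero;
    the sum of their squares is then the squared diameter. *)
Lemma geodesic_min e P X : SU P -> Gr n./2 X ->
  min_geod_seg P (expi (diam_angle e) *: P) (geodesic e P X).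
Proof.
move=> sP [hX [iX rX]].
have [V [d [uV XE d01 rE]]] := projection_diagonalizable hX iX.
rewrite (geodesic_diag e P uV XE d01).
set th := (X in diag_curve _ _ _ X).
have th0 : \sum_k th k = 0.
  apply: etrans (natr_sum01 _ _ d01) _; rewrite -rE rX /central_angle.
  have -> : (- (sgn e * pi) - sgn e * (o * pi / n%:R) - (sgn e * pi - sgn e * (o * pi / n%:R)))
    = - 2 * sgn e * pi by ring.
  have -> : n%:R * (sgn e * pi - sgn e * (o * pi / n%:R)) = (n%:R - o) * (sgn e * pi)
    by field; rewrite gt_eqF.
  by rewrite [X in X - o]nE; ring.
have th2 : \sum_k th k ^+ 2 = (n%:R - o / n%:R) * pi ^+ 2.
  rewrite (eq_bigr (fun k => if d 0 k == 0 then (sgn e * pi - central_angle e) ^+ 2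
      else (- (sgn e * pi) - central_angle e) ^+ 2)); last first.
    by move=> k _; rewrite /th; case: ifP.
  apply: etrans (natr_sum01 _ _ d01) _; rewrite -rE rX.
  have -> : (- (sgn e * pi) - central_angle e) ^+ 2 - (sgn e * pi - central_angle e) ^+ 2
    = 4 * (sgn e ^+ 2) * (o * pi ^+ 2 / n%:R) by rewrite /central_angle; ring.
  have -> : (sgn e * pi - central_angle e) ^+ 2 =
    sgn e ^+ 2 * pi ^+ 2 * (1 - 2 * o / n%:R + o ^+ 2 / n%:R ^+ 2).
    by rewrite /central_angle; field; rewrite gt_eqF.
  have -> : (n./2)%:R = (n%:R - o) / 2 :> R by rewrite [X in X - o]nE; field.
  rewrite sgn2 o2.
  have -> : n%:R * (1 * pi ^+ 2 * (1 - 2 * o / n%:R + o / n%:R ^+ 2)) +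
      (n%:R - o) / 2 * (4 * 1 * (o * pi ^+ 2 / n%:R)) =
      (n%:R - o / n%:R) * pi ^+ 2 + 2 * (o - o ^+ 2) / n%:R * pi ^+ 2.
    by field; rewrite gt_eqF.
  by rewrite o2 subrr mulr0 !mul0r addr0.
have [ag sp] := diag_curve_admissible sP uV th0.
(* The two angles differ by 2 pi, so at time 1 the exponential is scalar, whatever X is. *)
have end1 : P *m (adj V *m diag_mx (\row_k expi (th k)) *m V) = expi (diam_angle e) *: P.
  have -> : diag_mx (\row_k expi (th k)) = (expi (diam_angle e))%:M.
    apply/matrixP => i j; rewrite !mxE; congr (_ *+ _); rewrite /th diam_angleE.
    case: ifP => // _; rewrite !expiD; congr (_ * _).
    by rewrite expi_sgn_pi -(@conjc_expi R) expi_sgn_pi rmorphN1.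
  by rewrite mul_mx_scalar -scalemxAl unitary_comm // -scalemxAr mulmx1.
rewrite end1 in ag.
have sE : Num.sqrt (\sum_k th k ^+ 2) = diam_value.
  by rewrite th2 -diam_value_sqr sqrtr_sqr ger0_norm // diam_value_ge0.
rewrite /min_geod_seg /= dist_diam_point //; split=> //; split.
  by rewrite (length_cst_speed (fun t _ => sp t)).
by move=> t _; rewrite sp.
Qed.

(** The eigenvalues on the image and on the kernel of X differ, up to a common phase, by -2 i sin (a
    t); [expi (pi / 2)] is i. *)
Lemma geodesic_dist e P X Y t : SU P ->
  frob (geodesic e P X t - geodesic e P Y t) = 2 * `|sin (pi * t)| * frob (X - Y).
Proof.
move=> [uP _]; set a := sgn e * pi.
have -> : geodesic e P X t - geodesic e P Y t =
    expi (- central_angle e * t) *: (expi (pi / 2) *: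
      ((- 2 * sin (a * t))%:C%C *: (P *m (X - Y)))).
  rewrite /geodesic -mulmxBr !scalemxAr; congr (_ *m _).
  rewrite !(mulrDl _ _ t) !expiD -/a !scalerA.
  have -> : expi (- central_angle e * t) * expi (pi / 2) * (- 2 * sin (a * t))%:C%C =
    expi (- central_angle e * t) * (expi (- a * t) - expi (a * t)).
    rewrite -mulrA; congr (_ * _).
    rewrite !mulNr /expi cos_pihalf sin_pihalf cosN sinN.
    by apply/eqP; rewrite eq_complex /=; apply/andP; split; apply/eqP; ring.
  by apply/matrixP => i j; rewrite !mxE; ring.
have u1 (x : R) (A : M) : frob (expi x *: A) = frob A.
  by apply: frob_unit; rewrite (@conjc_expi R) expiK.
rewrite !u1 frobZ frob_mul // normrM normrN; congr (_ * _ * _).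
  by rewrite ger0_norm.
by rewrite /a {a} /sgn; case: e; rewrite ?expr1 ?expr0 ?mul1r // mulN1r mulNr sinN normrN.
Qed.

Lemma expi_sgnE e (x : R) :
  expi (sgn e * x) = (cos x)%:C%C + (0 +i* sgn e)%C * (sin x)%:C%C.
Proof.
rewrite /expi /sgn; apply/eqP; rewrite eq_complex /=.
by case: e; rewrite ?expr1 ?expr0 ?mulN1r ?mul1r ?cosN ?sinN; apply/andP; split; apply/eqP; ring.
Qed.

(** Unitarity of the great circle at two times gives Z^* = -Z and Z^2 = -1, hence a projection X;
    the determinant then fixes its rank. *)
Lemma min_geod_seg_geodesic e P (g : R -> M) : SU P ->
  min_geod_seg P (expi (diam_angle e) *: P) g ->
  exists X, Gr n./2 X /\ same_on01 g (geodesic e P X).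
Proof.
move=> sP [ag [_ sp]]; have [uP dP] := sP; have uP' := unitary_comm uP.
rewrite dist_diam_point // in sp.
have [q gq] := antipodal_minimizer n0 ag (expi_central_diam e P) sp (diam_value_central e).
have [gC [gSU [g0 g1]]] := ag.
set b := central_angle e in gq.
have pi0 := pi_gt0 R.
have u1 (x : R) : expi x * ((expi x)^*)%C = 1 by rewrite (@conjc_expi R) expiK.
pose Z := adj P *m q.
pose U t := (cos (pi * t))%:C%C *: (1%:M : M) + (sin (pi * t))%:C%C *: Z.
have gU (t : R) : 0 <= t <= 1 -> expi (b * t) *: g t = P *m U t.
  move=> t01; rewrite gq // /U mulmxDr -!scalemxAr mulmx1 /Z mulmxA uP mul1mx //.
have uU (t : R) : 0 <= t <= 1 -> U t *m adj (U t) = 1%:M.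
  move=> t01; have -> : U t = expi (b * t) *: (adj P *m g t).
    by rewrite scalemxAr gU // mulmxA uP' mul1mx.
  have [ug _] := SU_mul (SU_adj sP) (gSU t t01).
  by rewrite adjmxZ -scalemxAl -scalemxAr scalerA u1 ug scale1r.
have adjU t : adj (U t) = (cos (pi * t))%:C%C *: 1%:M + (sin (pi * t))%:C%C *: adj Z.
  by rewrite adjmxD !adjmxZ adjmx1 !conjc_real.
(* At t = 1/2 the cosine vanishes and U is Z. *)
have uZ : Z *m adj Z = 1%:M.
  have := uU 2^-1; rewrite adjU /U cos_pihalf sin_pihalf !scale0r !add0r !scale1r.
  by apply; apply/andP; split; lra.
have aZ : adj Z = - Z.
  have q01 : 0 <= (4^-1 : R) <= 1 by apply/andP; split; lra.
  have := uU 4^-1 q01; rewrite adjU /U.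
  have c0 : 0 < cos (pi * 4^-1) :> R by apply: cos_gt0_pihalf; apply/andP; split; lra.
  have s0 : 0 < sin (pi * 4^-1) :> R by apply: sin_gt0_pihalf; apply/andP; split; lra.
  have cs := cos2Dsin2 (pi * 4^-1 : R).
  move: (cos _) (sin _) c0 s0 cs => c s c0 s0 cs.
  rewrite mulmxDl !mulmxDr -!scalemxAl -!scalemxAr uZ mulmx1 mul1mx mulmx1 !scalerA.
  move=> E; have {}E : (c * s)%:C%C *: (adj Z + Z) = 0.
    have c1 : (1%:M : M) = (c * c + s * s)%:C%C *: 1%:M by rewrite -!expr2 cs scale1r.
    move: E; rewrite [RHS]c1 rmorphD scalerDl !rmorphM scalerDr [s%:C%C * c%:C%C]mulrC => E.
    apply: (addrI (c%:C%C * c%:C%C *: 1%:M)); apply: (addIr (s%:C%C * s%:C%C *: 1%:M)).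
    by rewrite addr0 -E !addrA.
  apply/eqP; rewrite -addr_eq0; move/eqP: E; rewrite scaler_eq0 => /orP[|//].
  by rewrite (fmorph_eq0 (real_complex R)) mulf_eq0 !gt_eqF.
have ZZ : Z *m Z = - 1%:M by rewrite -[Z in _ *m Z]opprK -aZ mulmxN uZ.
pose w : R[i] := (0 +i* sgn e)%C.
have w2 : w * w = -1.
  apply/eqP; rewrite eq_complex /=; apply/andP; split; apply/eqP; last by ring.
  by rewrite mul0r sub0r -expr2 sgn2.
have wc : ((w)^*)%C = - w by apply/eqP; rewrite eq_complex /= oppr0 !eqxx.
have h2 : (2^-1 : R[i]) + 2^-1 = 1 by rewrite -mulr2n -[LHS]mulr_natr mulVf ?pnatr_eq0.
(* As w^2 = Z^2 = -1, the matrix w Z is a Hermitian involution, and X is its spectral projection for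
   the eigenvalue 1. *)
pose X := (2^-1 : R[i]) *: (1%:M + w *: Z).
have h2c : ((2^-1 : R[i])^*)%C = 2^-1 by rewrite fmorphV rmorph_nat.
have hX : adj X = X.
  by rewrite /X adjmxZ adjmxD adjmxZ adjmx1 wc aZ h2c scaleNr scalerN opprK.
have iX : X *m X = X.
  rewrite /X -scalemxAl -scalemxAr mulmxDl !mulmxDr -!scalemxAl -!scalemxAr ZZ.
  rewrite mul1mx mulmx1 mul1mx scalerA w2 scaleN1r opprK; congr (_ *: _).
  apply/matrixP => i j; rewrite !mxE; move: (w * _) ((i == j)%:R) => x y.
  have -> : 2^-1 * (y + x + (x + y)) = (2^-1 + 2^-1) * (y + x) by ring.
  by rewrite h2 mul1r.
have UX t : U t = expi (sgn e * (pi * t)) *: (1%:M - X) + expi (- (sgn e * (pi * t))) *: X.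
  rewrite -mulrN !expi_sgnE cosN sinN -/w /X /U.
  have -> : (- sin (pi * t))%:C%C = - (sin (pi * t))%:C%C by rewrite rmorphN.
  move: (Z) => Z'; apply/matrixP => i j; rewrite !mxE.
  move: (cos _)%:C%C (sin _)%:C%C (Z' i j) ((i == j)%:R) => c s z y.
  have -> : (c + w * s) * (y - 2^-1 * (y + w * z)) + (c + w * - s) * (2^-1 * (y + w * z)) =
    c * y + w * s * y * (1 - (2^-1 + 2^-1)) - (2^-1 + 2^-1) * (w * w) * s * z by ring.
  by rewrite h2 w2; ring.
have gX (t : R) : 0 <= t <= 1 -> g t = geodesic e P X t.
  move=> t01; transitivity (expi (- (b * t)) *: (expi (b * t) *: g t)).
    by rewrite scalerA mulrC expiK scale1r.
  rewrite gU // scalemxAr; congr (_ *m _); rewrite UX scalerDr !scalerA -!expiD.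
  by congr (expi _ *: _ + (expi _ / 2) *: _); rewrite -/b; ring.
exists X; split; last exact: gX.
split=> //; split=> //.
have [V [d [uV XE d01 rE]]] := projection_diagonalizable hX iX.
(* At time 1/n the determinant has the angle pi |n - o - 2 r| / n up to sign. It is below 2 pi
   because |n - o - 2 r| <= n + 1 < 2 n, so determinant 1 forces 2 r = n - o. *)
have ninv : 0 <= (n%:R^-1 : R) <= 1.
  by rewrite invr_ge0 (ltW N0) invf_le1 // ler1n n0.
have [_] := gSU _ ninv; rewrite gX // (geodesic_diag e P uV XE d01) /diag_curve.
rewrite -!mulmxA det_mulmx dP mul1r mulmxA det_conj_diag //.
move=> detE.
pose th k : R := if d 0 k == 0 then sgn e * pi - central_angle e
                 else - (sgn e * pi) - central_angle e.
have : expi ((\sum_k th k) * n%:R^-1) = 1.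
  rewrite -[RHS]detE mulr_suml expi_sum; apply: eq_bigr => k _.
  by rewrite mxE mul1r.
have -> : \sum_k th k = sgn e * pi * (n%:R - o - 2 * (\rank X)%:R).
  apply: etrans (natr_sum01 _ _ d01) _; rewrite -rE /central_angle.
  by field; rewrite gt_eqF.
have rn : (\rank X)%:R <= n%:R :> R by rewrite ler_nat rank_leq_row.
have r0 : 0 <= (\rank X)%:R :> R by [].
have o1 : 0 <= o <= 1 by case: (odd n); rewrite ?ler01 ?lexx.
have n2' : 2 <= n%:R :> R by rewrite ler_nat.
move: (\rank X) rn r0 => r rn r0 /expi_eq1 H.
suff : n%:R - o - 2 * r%:R = 0.
  rewrite nE addrK => /eqP; rewrite -mulrBr mulf_eq0 pnatr_eq0 /= subr_eq0 eqr_nat.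
  by move=> /eqP.
have /eqP : sgn e * pi * (n%:R - o - 2 * r%:R) / n%:R = 0.
  apply: H; set y := _ - _ - _.
  have : `|sgn e * pi * y / n%:R| < 2 * pi.
    have -> : `|sgn e * pi * y / n%:R| = pi * (`|y| / n%:R).
      rewrite !normrM [`|n%:R^-1|]ger0_norm ?invr_ge0 ?(ltW N0) // [`|pi|]gtr0_norm //.
      by rewrite /sgn normrX normrN1 expr1n mul1r mulrA.
    rewrite mulrC ltr_pM2r // ltr_pdivrMr //.
    by rewrite ltr_norml /y; case/andP: o1 => ? ?; apply/andP; split; lra.
  by rewrite ltr_norml.
have sn0 : sgn e != 0 by rewrite /sgn expf_neq0 // oppr_eq0 oner_eq0.
by rewrite !mulf_eq0 (negPf sn0) invr_eq0 (gt_eqF pi0) (gt_eqF N0) /= orbF => /eqP.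
Qed.

(** At the midpoint the curves of X and Y are exactly 2 |X - Y| apart, which gives injectivity and a
    continuous inverse; elsewhere they are at most that far apart, which gives continuity. *)
Lemma min_geod_seg_parametrized e P : SU P ->
  parametrized_by (min_geod_seg P (expi (diam_angle e) *: P)) (@Gr R n n./2).
Proof.
move=> sP; have half : 0 <= (2^-1 : R) <= 1 by apply/andP; split; lra.
have at_half X Y : frob (geodesic e P X 2^-1 - geodesic e P Y 2^-1) = 2 * frob (X - Y).
  by rewrite geodesic_dist // sin_pihalf normr1 mulr1.
exists (geodesic e P); split; first by move=> X; exact: geodesic_min.
split; first by move=> g; exact: min_geod_seg_geodesic.
split.
  move=> X Y _ _ /(_ _ half) E; have := at_half X Y; rewrite E subrr.
  rewrite /frob frob_innerE big1 ?sqrtr0 => [|k _]; last first.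
    by rewrite /crd !mxE; case: (k.2); rewrite mul0r.
  move/esym/eqP; rewrite mulf_eq0 pnatr_eq0 /= sqrtr_eq0 => h.
  by apply/eqP; rewrite -subr_eq0; apply/eqP/frob_eq0/eqP; rewrite eq_le h frob_inner_ge0.
split=> X _ eps eps0.
  exists (eps / 2); first by rewrite divr_gt0.
  move=> Y _ XY t _; rewrite geodesic_dist //.
  have s1 : `|sin (pi * t)| <= 1 by exact: sin_max.
  have f0 := frob_ge0 (X - Y); have a0 := normr_ge0 (sin (pi * t)); nra.
exists eps => // Y _ /(_ _ half); rewrite at_half.
have f0 := frob_ge0 (X - Y); lra.
Qed.

End Distance.

(** * Diameter, diametral points and minimizing segments for each parity *)

Unset Implicit Arguments. Set Strict Implicit.

Theorem theorem5p2 (R : realType) (n : nat) (hn : (2 <= n)%N) :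
  (diam R n = (if odd n then Num.sqrt (n%:R - n%:R^-1) * pi
               else Num.sqrt n%:R * pi)) /\
  (~~ odd n -> forall P : 'M[R[i]]_n, SU P ->
     (forall Q, diametral P Q <-> Q = - P) /\
     parametrized_by (min_geod_seg P (- P)) (@Gr R n n./2)) /\
  (odd n -> forall P : 'M[R[i]]_n, SU P ->
     let Pp := expi ((n%:R - 1) * pi / n%:R) *: P in
     let Pm := expi (- ((n%:R - 1) * pi / n%:R)) *: P in
     Pp <> Pm /\
     (forall Q, diametral P Q <-> Q = Pp \/ Q = Pm) /\
     parametrized_by (min_geod_seg P Pp) (@Gr R n n./2) /\
     parametrized_by (min_geod_seg P Pm) (@Gr R n n./2)).
Proof.
have N2 : 2 <= n%:R :> R by rewrite ler_nat.
have pi0 := pi_gt0 R.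
split; last split.
- rewrite diamE // /diam_value; case: (odd n); first by rewrite mul1r.
  by rewrite mul0r subr0.
- move=> /negPf even_n P sP.
  (* For even n both signs lead to the same point -P. *)
  have QE e : expi (diam_angle R n e) *: P = - P.
    by rewrite /diam_angle even_n !mul0r subr0 expi_sgn_pi scaleN1r.
  split; last by rewrite -(QE false); exact: min_geod_seg_parametrized.
  move=> Q; rewrite (diametralP hn _ sP); split; first by move=> [e ->].
  by move=> ->; exists false.
move=> odd_n P sP Pp Pm.
have angle : pi - 1 * pi / n%:R = (n%:R - 1) * pi / n%:R :> R by field; rewrite gt_eqF //; lra.
have PpE : Pp = expi (diam_angle R n false) *: P.
  by rewrite /diam_angle /sgn odd_n expr0 mul1r angle.
have PmE : Pm = expi (diam_angle R n true) *: P.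
  by rewrite /diam_angle /sgn odd_n expr1 mulN1r angle.
split; last first.
  split; last by rewrite PpE PmE; split; exact: min_geod_seg_parametrized.
  move=> Q; rewrite (diametralP hn _ sP) PpE PmE; split=> [[[] ->]|[->|->]].
  - by right.
  - by left.
  - by exists false.
  - by exists true.
(* If the two points agreed, then e^{2 i a} = 1 with 0 < 2 a < 2 pi. *)
rewrite /Pp /Pm => E; set a : R := (n%:R - 1) * pi / n%:R in E.
have a0 : 0 < a < pi.
  have nV : n%:R^-1 <= 2^-1 :> R by rewrite lef_pV2 ?posrE //; lra.
  have nV0 : 0 < n%:R^-1 :> R by rewrite invr_gt0; lra.
  have -> : a = pi * (1 - n%:R^-1) by rewrite /a; field; rewrite gt_eqF //; lra.
  by apply/andP; split; nra.
have : expi (a + a) = 1.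
  have [uP _] := sP.
  have /matrixP/(_ (Ordinal (ltnW hn)) (Ordinal (ltnW hn))) :
      (expi a *: P) *m adj P = (expi (- a) *: P) *m adj P by rewrite E.
  rewrite -!scalemxAl uP !mxE eqxx !mulr1 => ea.
  by rewrite expiD {1}ea mulrC expiK.
move/expi_eq1 => H; case/andP: a0 => a1 a2.
by have : a + a = 0 by [apply: H; apply/andP; split; lra]; lra.
Qed.
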